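(* A nonempty polytope is a fertilitope if and only if it is an integral binary nestohedron.
   Context: A permutation of size $n\ge 1$ is an ordering $\pi=\pi_1\cdots\pi_n$ of a set of $n$ distinct positive integers. A descent of $\pi$ is an index $i\in[n-1]$ with $\pi_i>\pi_{i+1}$. The plot of $\pi$ is the set of points $(i,\pi_i)$, $i\in[n]$. A hook of $\pi$ with southwest endpoint $(i,\pi_i)$ and northeast endpoint $(j,\pi_j)$, where $i<j$ and $\pi_i<\pi_j$, is the union of the vertical segment from $(i,\pi_i)$ to $(i,\pi_j)$ and the horizontal segment from $(i,\pi_j)$ to $(j,\pi_j)$. A point $(m,\pi_m)$ lies directly above (respectively, below) this hook if $i<m<j$ and $\pi_m>\pi_j$ (respectively, $\pi_m<\pi_j$). Let $d_1<\cdots<d_k$ be the descents of $\pi$. A valid hook configuration of $\pi$ is a tuple $\mathcal H=(H_1,\ldots,H_k)$ of hooks of $\pi$ such that: (1) $H_i$ has southwest endpoint $(d_i,\pi_{d_i})$ for each $i$; (2) no point of the plot lies directly above a hook of $\mathcal H$; (3) no two hooks of $\mathcal H$ intersect or overlap, except that the northeast endpoint of one may be the southwest endpoint of another. (If $k=0$, there is exactly one, the empty configuration.) Let $\mathrm{VHC}(\pi)$ be the set of valid hook configurations of $\pi$. Each $\mathcal H\in\mathrm{VHC}(\pi)$ induces a coloring of the $n-k$ points of the plot that are not northeast endpoints of hooks of $\mathcal H$: such a point $(m,\pi_m)$ gets the color of the lowest hook of $\mathcal H$ lying above it (i.e. among the hooks of $\mathcal H$ below which it lies, the one whose northeast endpoint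 has smallest height; a hook is not considered to lie above its own southwest endpoint), and the color of the ''sky'' if there is no such hook. Let $q_i$ be the number of points with the color of $H_i$ ($1\le i\le k$) and $q_0$ the number with the color of the sky. Then $\mathbf q^{\mathcal H}=(q_0,\ldots,q_k)$ is a composition of $n-k$ into $k+1$ (positive) parts. Set $\mathcal V(\pi)=\{\mathbf q^{\mathcal H}:\mathcal H\in\mathrm{VHC}(\pi)\}$, the set of valid compositions of $\pi$. The fertilitope of $\pi$ is $\mathrm{Fer}_\pi=\mathrm{conv}(\mathcal V(\pi))\subseteq\mathbb R^{k+1}$. A fertilitope is a polytope of the form $\mathrm{Fer}_\pi$ for some permutation $\pi$. A binary building set on $[k+1]=\{1,\ldots,k+1\}$ ($k\ge 0$) is a collection $\mathcal B$ of nonempty subsets of $[k+1]$ such that every set in $\mathcal B$ is an interval $\{i,i+1,\ldots,j\}$, every singleton subset of $[k+1]$ is in $\mathcal B$, and any two non-disjoint $I,J\in\mathcal B$ satisfy $I\subseteq J$ or $J\subseteq I$. For $I\subseteq[k+1]$ let $\Delta_I=\mathrm{conv}(\{e_i:i\in I\})\subseteq\mathbb R^{k+1}$, where $e_1,\ldots,e_{k+1}$ is the standard basis. A binary nestohedron is a Minkowski sum $\sum_{I\in\mathcal B}y_I\Delta_I$, where $\mathcal B$ is a binary building set on $[k+1]$ for some $k\ge0$ and every $y_I$ is a positive real number. A polytope is integral if all its vertices have integer coordinates. All polytopes are convex. *)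

(* Defs.v *)
From HB Require Import structures.
From mathcomp Require Import all_boot all_order all_algebra.
From mathcomp Require Import boolp classical_sets reals convex.

Set Implicit Arguments.
Unset Strict Implicit.
Unset Printing Implicit Defensive.

Import Order.TTheory GRing.Theory Num.Theory.

Local Open Scope classical_set_scope.
Local Open Scope ring_scope.

(** Polytopes in R^n, represented as sets of row vectors *)

Definition convex_hull (R : realType) (n : nat) (V : set 'rV[R]_n) :
  set 'rV[R]_n := smallest (@convex_set R 'rV[R]_n) V.

Definition polytope (R : realType) (n : nat) (P : set 'rV[R]_n) : Prop :=
  exists V : seq 'rV[R]_n, P = convex_hull [set` V].

(* x is a vertex of P when {x} is a face of P, i.e. some linear functional
   attains its maximum over P at x and nowhere else *)
Definition vertex (R : realType) (n : nat) (P : set 'rV[R]_n) (x : 'rV[R]_n) :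
  Prop :=
  P x /\ exists c : 'cV[R]_n,
    forall y, P y -> y != x -> (y *m c) 0 0 < (x *m c) 0 0.

Definition integral_polytope (R : realType) (n : nat) (P : set 'rV[R]_n) :
  Prop := forall x, vertex P x -> forall i, x 0 i \is a Num.int.

(** Permutations and hooks.  Positions are numbered from 0 rather than from 1,
    so the plot is translated by one unit to the left. *)

Definition permutation (s : seq nat) : bool :=
  [&& (0 < size s)%N, uniq s & all (leq 1) s].

Definition descents (s : seq nat) : seq nat :=
  [seq i <- iota 0 (size s).-1 | (nth 0 s i.+1 < nth 0 s i)%N].

(* A hook is encoded by the positions (i, j) of its endpoints, southwest
   first. *)
Definition is_hook (s : seq nat) (h : nat * nat) : bool :=
  [&& (h.1 < h.2)%N, (h.2 < size s)%N & (nth 0 s h.1 < nth 0 s h.2)%N].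

Definition plot_point (R : realType) (s : seq nat) (i : nat) : R * R :=
  (i%:R, (nth 0%N s i)%:R).

Definition hook_set (R : realType) (s : seq nat) (h : nat * nat) :
  set (R * R) :=
  [set p | p.1 = h.1%:R /\ (nth 0%N s h.1)%:R <= p.2 <= (nth 0%N s h.2)%:R]
  `|` [set p | p.2 = (nth 0%N s h.2)%:R /\ h.1%:R <= p.1 <= h.2%:R].

Definition directly_above (s : seq nat) (h : nat * nat) (m : nat) : bool :=
  (h.1 < m < h.2)%N && (nth 0 s h.2 < nth 0 s m)%N.

Definition directly_below (s : seq nat) (h : nat * nat) (m : nat) : bool :=
  (h.1 < m < h.2)%N && (nth 0 s m < nth 0 s h.2)%N.

(** Valid hook configurations.  The equation on southwest endpoints forces k
    to be the number of descents of s. *)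

Definition valid_hook_configuration (R : realType) (k : nat) (s : seq nat)
    (H : k.-tuple (nat * nat)) : Prop :=
  [/\ all (is_hook s) H,
      [seq h.1 | h <- H] = descents s,
      forall (h : nat * nat) (m : nat), h \in H ->
        (m < size s)%N -> ~~ directly_above s h m
    & forall a b : 'I_k, a != b -> forall p : R * R,
        hook_set s (tnth H a) p -> hook_set s (tnth H b) p ->
        (p = plot_point R s (tnth H a).2 /\ p = plot_point R s (tnth H b).1) \/
        (p = plot_point R s (tnth H b).2 /\ p = plot_point R s (tnth H a).1)].

(* The color [None] is the sky, and [Some i] is the color of the hook
   [tnth H i]. *)
Definition has_color (k : nat) (s : seq nat) (H : k.-tuple (nat * nat))
    (m : nat) (c : option 'I_k) : bool :=
  if c is Some i then
    directly_below s (tnth H i) m &&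
    [forall j : 'I_k, directly_below s (tnth H j) m ==>
       (nth 0 s (tnth H i).2 <= nth 0 s (tnth H j).2)%N]
  else [forall j : 'I_k, ~~ directly_below s (tnth H j) m].

(* Part 0 counts the points colored by the sky, and part [lift ord0 i] those
   colored by [tnth H i]. *)
Definition composition_of (k : nat) (s : seq nat) (H : k.-tuple (nat * nat)) :
  'rV[nat]_k.+1 :=
  \row_(c < k.+1)
    count (fun m : nat => (m \notin [seq h.2 | h <- H]) &&
                    has_color s H m (unlift ord0 c))
          (iota 0 (size s)).

Definition valid_compositions (R : realType) (k : nat) (s : seq nat) :
  set 'rV[nat]_k.+1 :=
  [set composition_of s H | H in [set H | @valid_hook_configuration R k s H]].

Definition Fer (R : realType) (k : nat) (s : seq nat) : set 'rV[R]_k.+1 :=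
  convex_hull
    [set map_mx (fun q : nat => q%:R) q | q in @valid_compositions R k s].

Definition fertilitope (R : realType) (k : nat) (P : set 'rV[R]_k.+1) : Prop :=
  exists s : seq nat,
    [/\ permutation s, size (descents s) = k & P = @Fer R k s].

(** Binary nestohedra *)

Definition interval_set (n : nat) (I : {set 'I_n}) : Prop :=
  exists i j : 'I_n, (i <= j)%N /\ I = [set x : 'I_n | (i <= x <= j)%N]%SET.

Definition binary_building_set (n : nat) (B : {set {set 'I_n}}) : Prop :=
  [/\ finset.set0 \notin B,
      forall I, I \in B -> interval_set I,
      forall i : 'I_n, [set i]%SET \in B
    & forall I J, I \in B -> J \in B -> ~~ [disjoint I & J] ->
        (I \subset J) || (J \subset I)].

Definition simplex (R : realType) (n : nat) (I : {set 'I_n}) : set 'rV[R]_n :=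
  convex_hull [set delta_mx 0 i | i in [set` I]].

Definition minkowski_sum (R : realType) (n : nat) (B : {set {set 'I_n}})
    (Q : {set 'I_n} -> set 'rV[R]_n) : set 'rV[R]_n :=
  [set \sum_(I in B) p I | p in [set p | forall I, I \in B -> Q I (p I)]].

Definition binary_nestohedron (R : realType) (k : nat) (P : set 'rV[R]_k.+1) :
  Prop :=
  exists (B : {set {set 'I_k.+1}}) (y : {set 'I_k.+1} -> R),
    [/\ binary_building_set B,
        forall I, I \in B -> 0 < y I
      & P = minkowski_sum B (fun I => [set y I *: v | v in @simplex R k.+1 I])].

(* Main.v *)
Require Import Defs.
From mathcomp Require Import all_boot all_order all_algebra.
From mathcomp Require Import boolp classical_sets reals.
From mathcomp Require Import convex interval_inference zify lra.

(** Prepend to the permutation an infinite value at position 0, regarded as a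
    descent whose hook ends at the virtual position [n + 1]: the sky becomes an
    ordinary color.  A valid hook configuration is then a choice of a right end
    [T p] for every descent [p] such that the half-open intervals [(p, T p]]
    are nested or disjoint, and [q_p + 1] counts the positions whose innermost
    interval is [(p, T p]].  Such a [q] is realised if and only if it has the
    right total and, whenever all values at positions in [(p, x]] are smaller
    than the one at [p], the sum of [q_z + 1] over the descents [z] in [[p, x)]
    exceeds [x - p]: conversely, [T p] is the first [x] at which this fails.
    The inequalities for which the value at [x] is maximal on [(p, x]] imply
    all the others, and the sets of colors they involve form a laminar family
    of intervals; lower bounds on the sums over a laminar family (and a given
    total) define the lattice points of a Minkowski sum of dilated simplices.

    Conversely, exposing suitable vertices of an integral binary nestohedron
    shows that its coefficients are integers; refining the laminar family to a
    binary tree, one builds a permutation recursively from those of the two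
    subtrees so that the inequalities above become the prescribed ones. *)

Set Implicit Arguments.
Unset Strict Implicit.
Unset Printing Implicit Defensive.

Import Order.TTheory GRing.Theory Num.Theory.

Local Open Scope nat_scope.

(** * Nested right ends and class sizes *)

Lemma sum_nat_itv (a b c d : nat) : a <= c -> c <= d -> d <= b ->
  \sum_(a <= m < b) (c <= m < d) = d - c.
Proof.
move=> ac cd db.
rewrite (@big_cat_nat _ _ _ c) //=; last by lia.
rewrite (@big_cat_nat _ _ _ d c b) //=.
rewrite big_nat_cond big1 ?add0n; last by move=> i /andP[/andP[? ?] _]; lia.
rewrite [X in _ + X]big_nat_cond [X in _ + X]big1 ?addn0; last first.
  by move=> i /andP[/andP[? ?] _]; lia.
rewrite (eq_big_nat _ _ (F2 := fun=> 1)).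
  by rewrite sum_nat_const_nat muln1.
by move=> i /andP[-> ->].
Qed.

Lemma sum_nat_point (a b c : nat) : a <= c -> c < b ->
  \sum_(a <= m < b) (m == c) = 1.
Proof.
move=> ac cb; rewrite -[RHS](subSnn c) -(@sum_nat_itv a b c c.+1) //.
by apply: eq_bigr => i _; congr nat_of_bool; lia.
Qed.

(** In a nested family, the innermost interval around [m] is the one that starts last. *)
Definition innermost (dsc : pred nat) (T : nat -> nat) (p m : nat) : bool :=
  [&& dsc p, p < m <= T p &
      all (fun p' => (p < p') && dsc p' ==> (T p' < m)) (iota 0 m)].

Lemma innermostP (dsc : pred nat) (T : nat -> nat) (p m : nat) :
  reflect [/\ dsc p, p < m <= T p &
              forall p', dsc p' -> p < p' < m -> T p' < m]
          (innermost dsc T p m).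
Proof.
apply: (iffP and3P) => -[dp pm H]; split=> //.
  move=> p' dp' /andP[pp' p'm]; move/allP: H => /(_ p').
  by rewrite mem_iota /= add0n p'm pp' dp' /=; apply.
apply/allP => p'; rewrite mem_iota add0n /= => p'm.
by apply/implyP => /andP[pp' dp']; apply: H => //; rewrite pp'.
Qed.

Lemma innermost_inj (dsc : pred nat) (T : nat -> nat) (z z' m : nat) :
  innermost dsc T z m -> innermost dsc T z' m -> z = z'.
Proof.
move=> /innermostP[dz zm Hz] /innermostP[dz' zm' Hz'].
have [zz'|zz'|//] := ltngtP z z'.
  by have := Hz _ dz'; lia.
by have := Hz' _ dz; lia.
Qed.

(** If a later mark [p'] also covers [m], the search restarts from [p']; the distance [m - p] bounds
    the number of restarts. *)
Lemma innermost_ex (dsc : pred nat) (T : nat -> nat) (p m : nat) :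
  dsc p -> p < m <= T p -> exists2 z, p <= z < m & innermost dsc T z m.
Proof.
move: {2}(m - p) (leqnn (m - p)) => d.
elim: d p => [|d IH] p le_d dp pm; first by lia.
have [pown|] := boolP (innermost dsc T p m); first by exists p => //; lia.
rewrite /innermost dp pm /= => /allPn[p'].
rewrite mem_iota add0n /= => p'm; rewrite negb_imply => /andP[/andP[pp' dp'] Tp'].
have [|//||z zm own] := IH p'; [by lia | by lia |].
by exists z => //; lia.
Qed.

Definition class_size (n : nat) (dsc : pred nat) (T : nat -> nat) (p : nat) : nat :=
  \sum_(1 <= m < n.+2) innermost dsc T p m.

Lemma sum_innermost (dsc : pred nat) (T : nat -> nat) (p x m z : nat) :
  p <= z < x -> innermost dsc T z m -> \sum_(p <= y < x) innermost dsc T y m = 1.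
Proof.
move=> zx own; rewrite -(@sum_nat_point p x z); [|by lia|by lia].
apply: eq_bigr => y _; congr nat_of_bool; apply/idP/eqP => [own'|->//].
exact: innermost_inj own' own.
Qed.

Lemma sum_innermost0 (dsc : pred nat) (T : nat -> nat) (p x m : nat) :
  (forall z, p <= z < x -> ~~ innermost dsc T z m) ->
  \sum_(p <= y < x) innermost dsc T y m = 0.
Proof.
move=> H; rewrite big_nat_cond big1 // => i /andP[/H/negbTE-> _] //.
Qed.

Lemma sum_class_size (n : nat) (dsc : pred nat) (T : nat -> nat) (p x : nat) :
  \sum_(p <= z < x) class_size n dsc T z =
  \sum_(1 <= m < n.+2) \sum_(p <= z < x) innermost dsc T z m.
Proof. by rewrite /class_size exchange_big. Qed.

Definition nested (n : nat) (dsc : pred nat) (T : nat -> nat) : Prop :=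
  [/\ forall p, dsc p -> p < T p <= n.+1,
      forall p p', dsc p -> dsc p' -> p < p' < T p -> T p' < T p
    & T 0 = n.+1].

Lemma nested_innermost_end (n : nat) (dsc : pred nat) (T : nat -> nat) (p : nat) :
  nested n dsc T -> dsc p -> innermost dsc T p (T p).
Proof.
move=> [H1 H2 _] dp; apply/innermostP; split=> //.
  by rewrite leqnn andbT; case/andP: (H1 _ dp).
by move=> p' dp'; apply: H2.
Qed.

Lemma class_size_eq0 (n : nat) (dsc : pred nat) (T : nat -> nat) (p : nat) :
  ~~ dsc p -> class_size n dsc T p = 0.
Proof. by move=> dp; rewrite /class_size big1 // => m _; rewrite /innermost (negbTE dp). Qed.

(** The positions of [(p, x]] all have their innermost interval starting in [[p, x)], and so does
    [T p], which lies beyond [x]: this makes [x - p + 1] positions. *)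
Lemma sum_class_size_lb (n : nat) (dsc : pred nat) (T : nat -> nat) (p x : nat) :
  nested n dsc T -> dsc p -> p < x < T p ->
  x - p < \sum_(p <= z < x) class_size n dsc T z.
Proof.
move=> nT dp /andP[px xT]; have [H1 H2 H3] := nT.
have /andP[_ Tn] := H1 _ dp.
rewrite sum_class_size.
have <- : \sum_(1 <= m < n.+2) ((p < m < x.+1) + (m == T p)) = (x - p).+1.
  rewrite big_split /= (@sum_nat_itv 1 n.+2 p.+1 x.+1) ?sum_nat_point; lia.
apply: leq_sum => m _.
have [->|mT] := eqVneq m (T p).
  by rewrite (sum_innermost (z := p) _ (nested_innermost_end nT dp)); lia.
rewrite addn0; have [/andP[pm mx]|//] := boolP (p < m < x.+1).
have [|z zm own] := innermost_ex (T := T) (m := m) dp; first by lia.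
by rewrite (sum_innermost (z := z)) //; lia.
Qed.

(** By nesting, the positions whose innermost interval starts in [[p, T p)] are exactly those of
    [(p, T p]]. *)
Lemma sum_class_size_end (n : nat) (dsc : pred nat) (T : nat -> nat) (p : nat) :
  nested n dsc T -> dsc p ->
  \sum_(p <= z < T p) class_size n dsc T z = T p - p.
Proof.
move=> nT dp; have [H1 H2 H3] := nT.
have /andP[pT Tn] := H1 _ dp.
rewrite sum_class_size.
have -> : T p - p = \sum_(1 <= m < n.+2) (p.+1 <= m < (T p).+1).
  by rewrite sum_nat_itv //; lia.
apply: eq_bigr => m _.
have [/andP[pm mT]|npm] := boolP (p < m < (T p).+1).
  have [|z zm own] := innermost_ex (T := T) (m := m) dp; first by lia.
  by rewrite (sum_innermost (z := z)) //; lia.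
apply: sum_innermost0 => z zT; apply/negP => /innermostP[dz zm _].
have [zp|zp] := eqVneq z p; first by move: zm npm; rewrite zp; lia.
by have := H2 _ _ dp dz; lia.
Qed.

(* Induction from right to left: the sum over [[p, T p)] determines [Q p] once
   [Q] is known to the right of [p]. *)
Lemma class_size_unique (n : nat) (dsc : pred nat) (T Q : nat -> nat) :
  nested n dsc T -> (forall p, ~~ dsc p -> Q p = 0) ->
  (forall p, dsc p -> \sum_(p <= z < T p) Q z = T p - p) ->
  forall p, p <= n -> Q p = class_size n dsc T p.
Proof.
move=> nT Q0 QT p; have [H1 H2 H3] := nT.
have [d] := ubnP (n - p); elim: d p => // d IH p le_d pn.
have [dp|dp] := boolP (dsc p); last by rewrite Q0 ?class_size_eq0.
have /andP[pT Tn] := H1 _ dp.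
have E : \sum_(p.+1 <= i < T p) Q i = \sum_(p.+1 <= i < T p) class_size n dsc T i.
  by apply: eq_big_nat => i iT; apply: IH; lia.
have := QT _ dp; rewrite -(sum_class_size_end nT dp) big_ltn // E.
by rewrite [RHS]big_ltn // => /addIn.
Qed.

Definition dominance_bounds (n : nat) (w Q : nat -> nat) : Prop :=
  forall p x, p < x <= n -> (forall y, p < y <= x -> w y < w p) ->
    x - p < \sum_(p <= z < x) Q z.

(** The second clause combines two conditions on a hook: it goes up ([m = p]), and no point lies
    above it. Ends at the virtual position [n.+1] are exempt. *)
Definition valid_ends (n : nat) (w T : nat -> nat) (dsc : pred nat) : Prop :=
  nested n dsc T /\
  forall p m, dsc p -> p <= m < T p -> T p <= n -> w m < w (T p).

(** If [T p <= n], its value exceeds [w p], so [T p] cannot lie in a stretch [(p, x]] dominated by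
    [p]. In every case [x < T p], and [sum_class_size_lb] applies. *)
Lemma valid_ends_dominance_bounds (n : nat) (w T : nat -> nat) (dsc : pred nat) :
  (forall p, dsc p = (p < n) && (w p.+1 < w p)) ->
  valid_ends n w T dsc -> dominance_bounds n w (class_size n dsc T).
Proof.
move=> dscE [nT vT] p x px pmax.
have dp : dsc p by rewrite dscE pmax; lia.
apply: sum_class_size_lb => //; have [H1 _ _] := nT.
have /andP[pT Tn] := H1 _ dp.
case: (ltnP x (T p)) => [|Tx]; first by lia.
have := vT p p dp; have := pmax (T p); lia.
Qed.

(** [T p] is the first [x > p] where the sum of [Q] over [[p, x)] no longer exceeds [x - p].
    Minimality makes the intervals nested, and dominance forces the value at [T p] above all those
    since [p]. *)
Lemma dominance_bounds_valid_ends (n : nat) (w Q : nat -> nat) (dsc : pred nat) :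
  (forall p, dsc p = (p < n) && (w p.+1 < w p)) ->
  (forall p, ~~ dsc p -> Q p = 0) ->
  (forall y, 0 < y <= n -> w y < w 0) -> 0 < n ->
  (forall i j, i <= n -> j <= n -> w i = w j -> i = j) ->
  dominance_bounds n w Q -> \sum_(0 <= z < n.+1) Q z = n.+1 ->
  exists T, valid_ends n w T dsc /\ forall p, dsc p -> Q p = class_size n dsc T p.
Proof.
move=> dscE Q0 w0 n0 winj sys tot.
have d0 : dsc 0 by rewrite dscE n0 w0 //; lia.
(* [F p x <= x] says that the inequality for [(p, x)] fails; keeping the summand [p] in [F] avoids
   subtraction. *)
pose F p x := p + \sum_(p <= z < x) Q z.
have F_cat p m x : p <= m <= x -> F p x + m = F p m + F m x.
  by move=> pmx; rewrite /F (@big_cat_nat _ _ _ m p x) /=; lia.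
have F_mono p x y : p <= x <= y -> F p x <= F p y.
  by move=> pxy; have := F_cat p x y pxy;
    have := leq_addr (\sum_(x <= z < y) Q z) x; rewrite -/(F x y); lia.
have F0 x : 0 < x <= n -> x < F 0 x.
  move=> xn; have := sys 0 x xn; rewrite subn0 /F add0n; apply=> y yx.
  by apply: w0; lia.
have F0n : F 0 n.+1 = n.+1 by rewrite /F tot.
have Q_gt0 p : dsc p -> 1 < Q p.
  rewrite dscE => /andP[pn wp].
  have : p.+1 - p < \sum_(p <= z < p.+1) Q z.
    by apply: sys => [|y yp]; [|have -> : y = p.+1]; lia.
  by rewrite big_nat1; lia.
have exT p : exists t, dsc p ->
    [/\ p < t <= n.+1, F p t = t & forall y, p < y < t -> y < F p y].
  have [dp|ndp] := boolP (dsc p); last by exists 0.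
  have pn : p < n by move: dp; rewrite dscE => /andP[].
  (* The search ends by [n.+1]: [F 0 n.+1] equals [n.+1] while [F 0 p > p] for [p > 0], so
     additivity leaves at most [n.+1] for [F p n.+1]. *)
  have ex : exists x, (p < x) && (F p x <= x).
    exists n.+1; rewrite ltnS (ltnW pn) /=.
    have [->|p0] := posnP p; first by rewrite F0n.
    by have := F_cat 0 p n.+1; rewrite F0n; have := F0 p; lia.
  have [x /andP[px Fx] xmin] := ex_minnP ex.
  exists x => _; split; last first.
  - by move=> y /andP[py yx]; rewrite ltnNge; apply/negP => Fy; have := xmin y; lia.
  (* Equality holds at the first failure, because [F p] is monotone and still exceeds [x.-1] at
     [x.-1]. The case [x = p.+1] is impossible, as [Q p > 1]. *)
  - apply/eqP; rewrite eqn_leq Fx /=.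
    have [->|xp] := eqVneq x p.+1.
      by rewrite /F big_nat1; have := Q_gt0 _ dp; lia.
    have := F_mono p x.-1 x; have : ~~ (F p x.-1 <= x.-1); last by lia.
    by apply/negP => Fy; have := xmin x.-1; lia.
  - rewrite px /=; apply: xmin; rewrite ltnS (ltnW pn) /=.
    have [->|p0] := posnP p; first by rewrite F0n.
    by have := F_cat 0 p n.+1; rewrite F0n; have := F0 p; lia.
have [T TP] := choice exT.
have nT : nested n dsc T.
  split.
  - by move=> p /TP[].
  - move=> p p' dp dp' pp'.
    have [H1 H2 H3] := TP _ dp; have [H1' H2' H3'] := TP _ dp'.
    (* Additivity turns [p' < F p p'] and [F p (T p) = T p] into a strict failure for [(p', T p)].
       So [T p' <= T p], and strictness excludes equality. *)
    have := F_cat p p' (T p); have := H3 p' pp'.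
    rewrite H2 => h1 h2; have h3 : F p' (T p) < T p by lia.
    rewrite ltnNge; apply/negP => le; have [E|ne] := eqVneq (T p) (T p').
      by move: h3; rewrite E H2'; lia.
    by have := H3' (T p); lia.
  - have [H1 H2 H3] := TP _ d0.
    have [E|ne] := eqVneq (T 0) n.+1; first by [].
    by have := F0 (T 0); rewrite H2; lia.
have [N1 N2 N3] := nT.
have Tsys p x : dsc p -> p < x <= n -> (forall y, p < y <= x -> w y < w p) ->
    x < T p.
  move=> dp px pmax; have [H1 H2 H3] := TP _ dp.
  rewrite ltnNge; apply/negP => Tx.
  have : T p - p < \sum_(p <= z < T p) Q z.
    by apply: sys => [|y yT]; [|apply: pmax]; lia.
  have -> : \sum_(p <= z < T p) Q z = T p - p by rewrite -{2}H2 /F addKn.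
  by rewrite ltnn.
exists T; split.
  split=> // p m0 dp m0T Tn.
  rewrite ltnNge; apply/negP => wTm.
  have ex : exists m, (p <= m < T p) && (w (T p) <= w m) by exists m0; rewrite m0T.
  have ub m : (p <= m < T p) && (w (T p) <= w m) -> m <= T p by lia.
  (* The last position [m] of [[p, T p)] with value at least [w (T p)] is a descent dominating
     [(m, T p]]. Then [Tsys] gives [T p < T m], which contradicts nesting, and is absurd if
     [m = p]. *)
  have [m /andP[mT wm] mmax] := ex_maxnP ex ub.
  have wlt : w (T p) < w m.
    rewrite ltn_neqAle wm andbT; apply/eqP => E.
    by have := winj (T p) m; lia.
  have aft y : m < y <= T p -> w y < w m.
    move=> my; have [->//|yT] := eqVneq y (T p).
    rewrite ltnNge; apply/negP => wy; have := mmax y; lia.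
  have dm : dsc m by rewrite dscE aft; lia.
  have lt : T p < T m by apply: Tsys => //; lia.
  have [E|mp] := eqVneq m p; first by move: lt; rewrite E ltnn.
  by have := N2 p m dp dm; lia.
move=> p dp; apply: (class_size_unique nT) => //; last by move: dp; rewrite dscE; lia.
move=> p' dp'; have [H1 H2 H3] := TP _ dp'.
by rewrite -{2}H2 /F addKn.
Qed.

(** * Hook configurations *)

Lemma mem_descents (s : seq nat) (p : nat) :
  (p \in descents s) = (p.+1 < size s) && (nth 0 s p.+1 < nth 0 s p).
Proof. by rewrite mem_filter mem_iota add0n /= andbC; case: s => //=; lia. Qed.

Lemma sorted_descents (s : seq nat) : sorted ltn (descents s).
Proof. by apply: sorted_filter; [exact: ltn_trans | exact: iota_ltn_sorted]. Qed.

(** Otherwise the vertical side of hook [b] meets the horizontal side of hook [a]: [b] starts no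
    higher than that side, having no point above [a], and ends at least as high, having no point
    above [b]. The meeting point is strictly between the ends of [a], so it is no shared
    endpoint. *)
Lemma nested_hooks_of_valid (R : realType) (k : nat) (s : seq nat)
    (H : k.-tuple (nat * nat)) (a b : 'I_k) :
  uniq s -> valid_hook_configuration R s H ->
  (tnth H a).1 < (tnth H b).1 < (tnth H a).2 -> (tnth H b).2 < (tnth H a).2.
Proof.
move=> us [/allP Hh _ Habove Hcross] /andP[ab ba].
have [ha hb] := (Hh _ (mem_tnth a H), Hh _ (mem_tnth b H)).
have neq : a != b by apply: contraTneq ab => ->; rewrite ltnn.
have := Habove _ _ (mem_tnth a H); have := Habove _ _ (mem_tnth b H).
have := Hcross _ _ neq; move: ha hb ab ba.
case: (tnth H a) (tnth H b) => [a1 a2] [b1 b2]; rewrite /is_hook /directly_above /=.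
move=> /and3P[a12 a2s wa] /and3P[b12 b2s wb] a1b1 b1a2 cross aboveb abovea.
rewrite ltnNge; apply/negP => a2b2.
have wb1 : nth 0 s b1 <= nth 0 s a2.
  by have := abovea b1 (ltn_trans b1a2 a2s); rewrite a1b1 b1a2 /= -leqNgt.
have wab : nth 0 s a2 <= nth 0 s b2.
  have [->//|ne] := eqVneq a2 b2.
  by have := aboveb a2 a2s; rewrite b1a2 ltn_neqAle ne a2b2 /= -leqNgt.
have := cross (b1%:R, (nth 0 s a2)%:R)%R; case.
- by right=> /=; rewrite !ler_nat (ltnW a1b1) (ltnW b1a2).
- by left=> /=; rewrite !ler_nat wb1 wab.
- by move=> [[/eqP]]; rewrite eqr_nat; lia.
- by move=> [_ [/eqP]]; rewrite eqr_nat; lia.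
Qed.

(** A hook [h] nested under [g] stays to the right of the vertical side of [g] and strictly below
    its horizontal side. A hook starting at or beyond [g.2] can only touch [g] at its northeast
    endpoint. *)
Lemma uncrossed_hooks (R : realType) (s : seq nat) (g h : nat * nat)
    (p : R * R) :
  uniq s -> is_hook s g -> is_hook s h ->
  (forall m, m < size s -> ~~ directly_above s g m) ->
  g.1 < h.1 -> (h.1 < g.2 -> h.2 < g.2) ->
  hook_set s g p -> hook_set s h p ->
  p = plot_point R s g.2 /\ p = plot_point R s h.1.
Proof.
case: g h p => [a1 a2] [b1 b2] [x y].
rewrite /is_hook /directly_above /hook_set /plot_point /=.
move=> us /and3P[a12 a2s wa] /and3P[b12 b2s wb] above a1b1 nest pa pb.
have xb : (b1%:R <= x)%R.
  by case: pb => -[/= E]; [rewrite E | case/andP].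
have ya : (y <= (nth 0 s a2)%:R)%R.
  by case: pa => -[/= E]; [case/andP | rewrite E].
have [b1a2|] := ltnP b1 a2.
  have ba2 := nest b1a2; exfalso.
  have wba : nth 0 s b2 < nth 0 s a2.
    have := above b2 (ltn_trans ba2 a2s).
    rewrite ba2 (ltn_trans a1b1 b12) /= -leqNgt leq_eqVlt nth_uniq //.
    by case/orP => // /eqP; lia.
  have yb : (y <= (nth 0 s b2)%:R)%R.
    by case: pb => -[/= E]; [case/andP | rewrite E].
  case: pa => -[/= E _].
    by move: xb; rewrite E ler_nat leqNgt a1b1.
  by move: yb; rewrite E ler_nat leqNgt wba.
move=> a2b1.
have a1a2 : (a1%:R < a2%:R :> R)%R by rewrite ltr_nat.
have a2b1R : (a2%:R <= b1%:R :> R)%R by rewrite ler_nat.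
have xa : (x <= a2%:R)%R.
  by case: pa => -[/= E]; [rewrite E => _; exact: ltW | case/andP => ? ?].
have Ex : (x = a2%:R)%R by apply/eqP; rewrite eq_le xa (le_trans a2b1R xb).
have E12 : a2 = b1.
  by apply/eqP; rewrite eqn_leq a2b1 -(ler_nat R) -Ex.
rewrite -E12 Ex; case: pa => -[/= E _]; last by rewrite E.
by move: a1a2; rewrite -Ex E ltxx.
Qed.

(** This trades the geometric condition over [R] for an order condition on positions. Hooks with
    different indices start at different descents, so one of them is the left one. *)
Lemma valid_hook_configurationP (R : realType) (k : nat) (s : seq nat)
    (H : k.-tuple (nat * nat)) :
  uniq s ->
  valid_hook_configuration R s H <->
  [/\ all (is_hook s) H, [seq h.1 | h <- H] = descents s,
      forall (h : nat * nat) (m : nat), h \in H ->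
        (m < size s)%N -> ~~ directly_above s h m
    & forall a b : 'I_k, (tnth H a).1 < (tnth H b).1 < (tnth H a).2 ->
        (tnth H b).2 < (tnth H a).2].
Proof.
move=> us; split=> [vH|[Hh HD Habove nest]].
  by have [? ? ? _] := vH; split=> // a b; exact: (nested_hooks_of_valid us vH).
split=> // a b neq p pa pb.
have [/allP Hh' uD] : all (is_hook s) H /\ uniq (descents s).
  by split=> //; exact: (sorted_uniq ltn_trans ltnn (sorted_descents s)).
have ne1 : (tnth H a).1 != (tnth H b).1.
  apply: contra_neq neq => E; apply: val_inj.
  have u1 : uniq [seq h.1 | h <- H] by rewrite HD.
  have sz (i : 'I_k) : i < size [seq h.1 | h <- H] by rewrite size_map size_tuple.
  apply/eqP; rewrite -(nth_uniq 0 (sz a) (sz b) u1).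
  by rewrite !(nth_map (0, 0)) ?size_tuple //= -!tnth_nth E.
case: (ltngtP (tnth H a).1 (tnth H b).1) ne1 => [lt _|lt _|-> /eqP] //.
  left; apply: (@uncrossed_hooks R s _ _ p us) pa pb => //; last 2 first.
  - by move=> m; apply: Habove; rewrite mem_tnth.
  - by move=> ba; apply: nest; rewrite lt.
  - by rewrite Hh' ?mem_tnth.
  - by rewrite Hh' ?mem_tnth.
right; apply: (@uncrossed_hooks R s _ _ p us) pb pa => //; last 2 first.
- by move=> m; apply: Habove; rewrite mem_tnth.
- by move=> ba; apply: nest; rewrite lt.
- by rewrite Hh' ?mem_tnth.
- by rewrite Hh' ?mem_tnth.
Qed.

(* [tnthP] restated at type [nat * nat], so that [lia] sees the same terms. *)
Lemma mem_hooks (k : nat) (H : k.-tuple (nat * nat)) (h : nat * nat) :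
  h \in H -> exists i : 'I_k, h = tnth H i.
Proof. by move/tnthP. Qed.

(* The descents of [s] shifted by one, together with the position 0 of the
   sentinel: entry 0 stands for the sky and entry [i.+1] for hook [i]. *)
Definition marks (s : seq nat) : seq nat := 0 :: [seq p.+1 | p <- descents s].

Lemma mem_marks (s : seq nat) (M p : nat) :
  0 < size s -> all (gtn M) s ->
  (p \in marks s) =
  (p < size s) && (nth 0 (M :: s) p.+1 < nth 0 (M :: s) p).
Proof.
move=> s0 /allP sM; rewrite in_cons; case: p => [|p] /=.
  by rewrite s0; apply/esym/sM; rewrite mem_nth.
by rewrite (mem_map succn_inj) mem_descents.
Qed.

Lemma sorted_marks (s : seq nat) : sorted ltn (marks s).
Proof.
rewrite /marks /= path_min_sorted; last by apply/allP => _ /mapP[p _ ->].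
rewrite sorted_map; have := sorted_descents s.
by apply: sub_sorted => x y.
Qed.

Definition ends_at (n k : nat) (H : k.-tuple (nat * nat)) (T : nat -> nat) :
  Prop :=
  T 0 = n.+1 /\ forall i, T (tnth H i).1.+1 = (tnth H i).2.+1.

Lemma marks_tnth (s : seq nat) (k : nat) (H : k.-tuple (nat * nat)) (i : 'I_k) :
  [seq h.1 | h <- H] = descents s ->
  nth 0 (marks s) (lift ord0 i) = (tnth H i).1.+1.
Proof.
have iH : i < size H by rewrite size_tuple.
by move=> HD; rewrite /marks -HD /= -map_comp (nth_map (0, 0)) //= -tnth_nth.
Qed.

Lemma marksP (s : seq nat) (k : nat) (H : k.-tuple (nat * nat)) (p : nat) :
  [seq h.1 | h <- H] = descents s ->
  reflect (p = 0 \/ exists i, p = (tnth H i).1.+1) (p \in marks s).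
Proof.
move=> HD; rewrite /marks in_cons -HD -map_comp.
apply: (iffP orP) => [[/eqP|/mapP[h /mem_hooks[i ->] ->]]|[->|[i ->]]].
- by left.
- by right; exists i.
- by left.
- by right; apply/mapP; exists (tnth H i) => //; apply: mem_tnth.
Qed.

Lemma valid_ends_of_hooks (s : seq nat) (M k : nat) (H : k.-tuple (nat * nat))
    (T : nat -> nat) :
  uniq s -> [seq h.1 | h <- H] = descents s -> ends_at (size s) H T ->
  all (is_hook s) H ->
  (forall (h : nat * nat) (m : nat), h \in H ->
     m < size s -> ~~ directly_above s h m) ->
  (forall a b : 'I_k, (tnth H a).1 < (tnth H b).1 < (tnth H a).2 ->
     (tnth H b).2 < (tnth H a).2) ->
  valid_ends (size s) (nth 0 (M :: s)) T (mem (marks s)).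
Proof.
move=> us HD [T0 TH] /allP Hh above nest.
have hk i : [/\ (tnth H i).1 < (tnth H i).2, (tnth H i).2 < size s &
      nth 0 s (tnth H i).1 < nth 0 s (tnth H i).2].
  by have /and3P := Hh _ (mem_tnth i H).
split; first split=> //.
- move=> p /(marksP _ HD)[->|[i ->]]; first by rewrite T0 /=.
  by have [h1 h2 _] := hk i; rewrite TH; lia.
- move=> p p' /(marksP _ HD)[->|[i ->]] /(marksP _ HD)[->|[j ->]] //.
    by rewrite T0 TH; have [_ h2 _] := hk j; lia.
  by rewrite !TH => pp'; have := nest i j; lia.
move=> p m /(marksP _ HD)[->|[i ->]]; first by rewrite T0 ltnn.
rewrite TH; case: m => // m mi ti /=.
have [h1 h2 h3] := hk i.
have [->//|mE] := eqVneq m (tnth H i).1.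
have ms : m < size s by lia.
have := above _ _ (mem_tnth i H) ms; rewrite /directly_above.
have -> /= : (tnth H i).1 < m < (tnth H i).2 by lia.
rewrite -leqNgt leq_eqVlt nth_uniq // => /orP[|//].
by lia.
Qed.

Lemma hooks_of_valid_ends (s : seq nat) (M k : nat) (H : k.-tuple (nat * nat))
    (T : nat -> nat) :
  [seq h.1 | h <- H] = descents s -> ends_at (size s) H T ->
  valid_ends (size s) (nth 0 (M :: s)) T (mem (marks s)) ->
  [/\ all (is_hook s) H,
      forall (h : nat * nat) (m : nat), h \in H ->
        m < size s -> ~~ directly_above s h m
    & forall a b : 'I_k, (tnth H a).1 < (tnth H b).1 < (tnth H a).2 ->
        (tnth H b).2 < (tnth H a).2].
Proof.
move=> HD [T0 TH] [[N1 N2 _] V].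
have mk i : (tnth H i).1.+1 \in marks s by apply/(marksP _ HD); right; exists i.
have mk0 : 0 \in marks s by [].
(* The interval of the sky contains every other mark, so nesting makes every other end smaller than
   [T 0], that is, a genuine position of the plot. *)
have hk i : (tnth H i).1 < (tnth H i).2 < size s.
  have := N2 _ _ mk0 (mk i); have := N1 _ (mk i); rewrite T0 TH; lia.
have hV i m : (tnth H i).1 <= m < (tnth H i).2 -> nth 0 s m < nth 0 s (tnth H i).2.
  by move=> mi; have := V _ m.+1 (mk i); rewrite TH /=; have := hk i; lia.
split.
- apply/allP => _ /mem_hooks[i ->]; have /andP[h1 h2] := hk i.
  by apply/and3P; split=> //; apply: hV; rewrite leqnn.
- move=> _ m /mem_hooks[i ->] ms; rewrite /directly_above; apply/negP => /andP[mi].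
  by have := hV i m; lia.
- by move=> a b ab; have := N2 _ _ (mk a) (mk b); rewrite !TH; lia.
Qed.

(** The lowest hook above a point is the innermost one: of two hooks spanning it, the one that
    starts later ends no higher ([higher]). The end of the interval is left out: it carries a
    northeast endpoint or, for the sky, lies beyond the plot. *)
Lemma innermost_has_color (s : seq nat) (M k : nat) (H : k.-tuple (nat * nat))
    (T : nat -> nat) (c : 'I_k.+1) (m : nat) :
  [seq h.1 | h <- H] = descents s -> ends_at (size s) H T ->
  valid_ends (size s) (nth 0 (M :: s)) T (mem (marks s)) ->
  m <= size s -> m.+1 != T (nth 0 (marks s) c) ->
  innermost (mem (marks s)) T (nth 0 (marks s) c) m.+1 =
  [&& m < size s, m \notin [seq h.2 | h <- H] &
      has_color s H m (unlift ord0 c)].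
Proof.
move=> HD [T0 TH] [nT V] mn mT; have [N1 N2 _] := nT.
have mk i : (tnth H i).1.+1 \in marks s by apply/(marksP _ HD); right; exists i.
have mk0 : 0 \in marks s by [].
have hk i : (tnth H i).1 < (tnth H i).2 < size s.
  have := N2 _ _ mk0 (mk i); have := N1 _ (mk i); rewrite T0 TH; lia.
have hV i j : (tnth H i).1 <= j < (tnth H i).2 -> nth 0 s j < nth 0 s (tnth H i).2.
  by move=> mi; have := V _ j.+1 (mk i); rewrite TH /=; have := hk i; lia.
have belowE i : directly_below s (tnth H i) m = ((tnth H i).1 < m < (tnth H i).2).
  by rewrite /directly_below; apply: andb_idr => mi; apply: hV; lia.
have higher i j : (tnth H j).1 <= (tnth H i).1 -> (tnth H i).1 < (tnth H j).2 ->
    nth 0 s (tnth H i).2 <= nth 0 s (tnth H j).2.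
  rewrite leq_eqVlt => /orP[/eqP E _|lt1 lt2].
    suff -> : (tnth H i).2 = (tnth H j).2 by [].
    by apply: succn_inj; rewrite -!TH E.
  have := N2 _ _ (mk j) (mk i); have := hV j (tnth H i).2; have := hk i.
  by rewrite !TH; lia.
apply/idP/and3P => [own|[ms mim col]].
  have [pm pT mx] := innermostP _ _ _ _ own.
  have pT1 := N1 _ pm.
  split; first by lia.
    apply/mapP => -[h /mem_hooks[i ->] E].
    have := nested_innermost_end nT (mk i); rewrite TH -E => own'.
    by move: mT; rewrite (innermost_inj own own') TH E eqxx.
  case: (unliftP ord0 c) => [i|] Ec; rewrite /has_color.
    move: pm mx mT pT; rewrite Ec (marks_tnth _ HD) TH => pm mx mT pT.
    rewrite belowE; apply/andP; split; first by lia.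
    apply/forallP => j; rewrite belowE; apply/implyP => jm.
    apply: higher; last by lia.
    rewrite leqNgt; apply/negP => ij.
    by have := mx _ (mk j); rewrite TH; lia.
  apply/forallP => j; rewrite belowE; apply/negP => jm.
  by have := mx _ (mk j); rewrite Ec TH /=; lia.
have [|z zm own] := innermost_ex (T := T) (m := m.+1) mk0; first by rewrite T0; lia.
suff -> : nth 0 (marks s) c = z by [].
have [zm1 zT mx] := innermostP _ _ _ _ own.
have mi j : m <> (tnth H j).2.
  by move=> E; move/mapP: mim; apply; exists (tnth H j); rewrite ?mem_tnth.
case: (unliftP ord0 c) col => [i|] ->; rewrite /has_color.
  rewrite belowE => /andP[im /forallP jm].
  rewrite (marks_tnth _ HD).
  have [zi|zi|//] := ltngtP (tnth H i).1.+1 z; last first.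
    by have := mx _ (mk i); rewrite TH; lia.
  case/(marksP _ HD): zm1 zi zT => [->//|[j ->]]; rewrite TH => ij jT.
  have jm' : (tnth H j).1 < m < (tnth H j).2 by have := mi j; lia.
  have := implyP (jm j); rewrite belowE => /(_ jm').
  have := N2 _ _ (mk i) (mk j); have := hV i (tnth H j).2; rewrite !TH; lia.
move/forallP => nb; case/(marksP _ HD): zm1 zT => [->//|[j ->]]; rewrite TH => jT.
by have := nb j; rewrite belowE; have := mi j; lia.
Qed.

(** The successor accounts for the end of the interval, which belongs to the class but carries no
    colored point. *)
Lemma composition_of_class_size (s : seq nat) (M k : nat) (H : k.-tuple (nat * nat))
    (T : nat -> nat) (c : 'I_k.+1) :
  [seq h.1 | h <- H] = descents s -> ends_at (size s) H T ->
  valid_ends (size s) (nth 0 (M :: s)) T (mem (marks s)) ->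
  size (descents s) = k ->
  (composition_of s H 0%R c).+1 =
  class_size (size s) (mem (marks s)) T (nth 0 (marks s) c).
Proof.
move=> HD eH vT sk; have [[N1 _ _] _] := vT; have [T0 TH] := eH.
set p := nth 0 (marks s) c.
have pm : p \in marks s by rewrite mem_nth // /marks /= size_map sk.
have /andP[pT Tn] := N1 _ pm.
rewrite /class_size big_add1 /= mxE.
pose P m := (m \notin [seq h.2 | h <- H]) && has_color s H m (unlift ord0 c).
rewrite -[count _ _]/(count P (iota 0 (size s))) -sum1_count.
rewrite (@eq_big_nat _ _ _ 0 (size s).+1 _
  (fun m => (m == (T p).-1) + ((m < size s) && P m))); last first.
  move=> m /andP[_ mn] /=.
  have [E|ne] := eqVneq m (T p).-1; last first.
    by rewrite (innermost_has_color (c := c) HD eH vT) //; rewrite -/p; lia.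
  have mE : m.+1 = T p by lia.
  rewrite -/p mE (nested_innermost_end (proj1 vT) pm).
  rewrite -mE; suff -> : (m < size s) && P m = false by [].
  apply/negP => /andP[ms /andP[mim _]]; move: mE; rewrite /p.
  case: (unliftP ord0 c) => [i|] ->; last by rewrite /= T0; lia.
  rewrite (marks_tnth _ HD) TH => -[E'].
  by move/mapP: mim; apply; exists (tnth H i); rewrite ?mem_tnth.
rewrite big_split /= sum_nat_point //; last by lia.
rewrite big_nat_recr //= ltnn addn0 add1n; congr _.+1.
rewrite big_mkcond /= -{1}(subn0 (size s)) -/(index_iota 0 (size s)).
by apply: eq_big_nat => m /andP[_ ->]; case: (P m).
Qed.

(** * Valid compositions as solutions of the dominance inequalities *)

Definition weight (D : seq nat) (q : nat -> nat) (z : nat) : nat :=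
  \sum_(0 <= i < size D | nth 0 D i == z) (q i).+1.

Lemma weight_notin (D : seq nat) (q : nat -> nat) (z : nat) :
  z \notin D -> weight D q z = 0.
Proof.
move=> zD; rewrite /weight big_nat_cond big1 // => i /andP[/andP[_ iD] /eqP E].
by rewrite -E mem_nth in zD.
Qed.

Lemma weight_nth (D : seq nat) (q : nat -> nat) (i : nat) :
  uniq D -> i < size D -> weight D q (nth 0 D i) = (q i).+1.
Proof.
move=> uD iD; rewrite /weight big_nat_cond (big_rem i) /=; last by rewrite mem_index_iota.
rewrite iD eqxx /= big1_seq ?addn0 // => j /andP[/andP[jD]].
rewrite nth_uniq // => /eqP ->.
by rewrite mem_rem_uniq ?iota_uniq // inE eqxx.
Qed.

Lemma sum_weight (D : seq nat) (q : nat -> nat) (a b : nat) :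
  \sum_(a <= z < b) weight D q z =
  \sum_(0 <= i < size D | a <= nth 0 D i < b) (q i).+1.
Proof.
rewrite /weight (exchange_big_dep predT) //= [RHS]big_mkcond /=.
apply: eq_bigr => i _; case: ifP => [iab|iab].
  rewrite (big_rem (nth 0 D i)) /=; last by rewrite mem_index_iota.
  rewrite eqxx big1_seq ?addn0 // => j /andP[/eqP ->].
  by rewrite mem_rem_uniq ?iota_uniq // inE eqxx.
rewrite big1_seq // => j /andP[/eqP E]; rewrite mem_index_iota -E iab //.
Qed.

Lemma eq_dominance_bounds (n : nat) (w Q Q' : nat -> nat) :
  Q =1 Q' -> dominance_bounds n w Q -> dominance_bounds n w Q'.
Proof.
by move=> E sys p x px pm; rewrite -(eq_bigr _ (fun z _ => E z)); apply: sys.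
Qed.

Lemma size_marks (s : seq nat) : size (marks s) = (size (descents s)).+1.
Proof. by rewrite /= size_map. Qed.

Lemma uniq_marks (s : seq nat) : uniq (marks s).
Proof. exact: (sorted_uniq ltn_trans ltnn (sorted_marks s)). Qed.

Lemma sum_weight_row (k : nat) (D : seq nat) (q : 'rV[nat]_k.+1) (P : pred nat) :
  size D = k.+1 ->
  \sum_(0 <= i < size D | P (nth 0 D i)) (q 0%R (inord i)).+1 =
  \sum_(i < k.+1 | P (nth 0 D i)) (q 0%R i).+1.
Proof.
by move=> ->; rewrite big_mkord; apply: eq_bigr => i _; rewrite inord_val.
Qed.

(** One direction reads the ends off the hooks; the other obtains them from
    [dominance_bounds_valid_ends] and turns them into hooks. [M] is the value of the sentinel. *)
Lemma valid_compositionsP (R : realType) (k : nat) (s : seq nat) (M : nat)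
    (q : 'rV[nat]_k.+1) :
  permutation s -> size (descents s) = k -> all (gtn M) s ->
  @valid_compositions R k s q <->
  dominance_bounds (size s) (nth 0 (M :: s)) (weight (marks s) (fun i => q 0%R (inord i))) /\
  \sum_(i < k.+1) (q 0%R i).+1 = (size s).+1.
Proof.
move=> /and3P[s0 us _] sk sM.
have szm : size (marks s) = k.+1 by rewrite size_marks sk.
have mle i : i < k.+1 -> nth 0 (marks s) i < (size s).+1.
  move=> ik; have : nth 0 (marks s) i \in marks s by rewrite mem_nth // szm.
  by rewrite (mem_marks _ s0 sM); lia.
have dscE p : mem (marks s) p =
    (p < size s) && (nth 0 (M :: s) p.+1 < nth 0 (M :: s) p).
  exact: mem_marks.
have tot (r : 'rV[nat]_k.+1) :
    \sum_(0 <= z < (size s).+1) weight (marks s) (fun i => r 0%R (inord i)) z =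
    \sum_(i < k.+1) (r 0%R i).+1.
  rewrite sum_weight (@sum_weight_row _ _ _ (fun z => 0 <= z < (size s).+1)) //.
  by apply: eq_bigl => i /=; rewrite mle.
have wE (T : nat -> nat) (r : 'rV[nat]_k.+1) :
    (forall c : 'I_k.+1, (r 0%R c).+1 =
       class_size (size s) (mem (marks s)) T (nth 0 (marks s) c)) ->
    class_size (size s) (mem (marks s)) T =1 weight (marks s) (fun i => r 0%R (inord i)).
  move=> rE z; have [zm|zm] := boolP (z \in marks s); last first.
    by rewrite weight_notin // class_size_eq0.
  have iz : index z (marks s) < k.+1 by rewrite -szm index_mem.
  rewrite -(nth_index 0 zm) weight_nth ?uniq_marks ?szm //.
  by rewrite rE inordK.
split=> [[H /(@valid_hook_configurationP R k s H us)[Hh HD above nest] <-]|[sys total]].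
  pose T p := nth 0 ((size s).+1 :: [seq h.2.+1 | h <- H]) (index p (marks s)).
  have eT : ends_at (size s) H T.
    split=> // i; have li : lift ord0 i < size (marks s) by rewrite szm.
    rewrite /T -(marks_tnth i HD) (index_uniq 0 li (uniq_marks s)) /=.
    have iH : i < size H by rewrite size_tuple.
    by rewrite (nth_map (0, 0)) // -tnth_nth.
  have vT := valid_ends_of_hooks M us HD eT Hh above nest.
  have cE c := composition_of_class_size c HD eT vT sk.
  split; first exact: eq_dominance_bounds (wE _ _ cE) (valid_ends_dominance_bounds dscE vT).
  rewrite -tot -(eq_bigr _ (fun z _ => wE _ _ cE z)).
  have [nT _] := vT; have [_ _ T0] := nT.
  by have := sum_class_size_end nT (mem_head _ _ : 0 \in marks s); rewrite T0 subn0.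
set Q := weight _ _ in sys.
have Q0 p : ~~ mem (marks s) p -> Q p = 0 by apply: weight_notin.
have w0 y : 0 < y <= size s -> nth 0 (M :: s) y < nth 0 (M :: s) 0.
  by case: y => //= y ys; apply: (allP sM); rewrite mem_nth.
have winj i j : i <= size s -> j <= size s ->
    nth 0 (M :: s) i = nth 0 (M :: s) j -> i = j.
  move=> si sj /eqP; rewrite nth_uniq //= ?us ?andbT => [/eqP//|].
  by apply/negP => /(allP sM) /=; rewrite ltnn.
have [|T [vT QE]] := dominance_bounds_valid_ends dscE Q0 w0 s0 winj sys; first by rewrite tot.
have [[N1 N2 T0] V] := vT.
(* The predecessor undoes the shift of positions caused by the sentinel. *)
have szH : size [seq (d, (T d.+1).-1) | d <- descents s] == k by rewrite size_map sk.
pose H := Tuple szH.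
have HD : [seq h.1 | h <- H] = descents s.
  by rewrite -map_comp -[RHS]map_id; apply: eq_map.
have eT : ends_at (size s) H T.
  split=> // i; have id : i < size (descents s) by rewrite sk.
  rewrite (tnth_nth (0, 0)) /= (nth_map 0) //=.
  have : (nth 0 (descents s) i).+1 \in marks s.
    by rewrite in_cons (mem_map succn_inj) mem_nth.
  by move/N1; lia.
have [Hh above nest] := hooks_of_valid_ends HD eT vT.
exists H; first exact/(@valid_hook_configurationP R k s H us).
apply/rowP => c; apply: succn_inj.
rewrite (composition_of_class_size c HD eT vT sk) -QE; last first.
  by rewrite /= mem_nth // szm.
by rewrite /Q weight_nth ?uniq_marks ?szm // inord_val.
Qed.

(** * Lower bounds over laminar families *)

Definition laminar (T : finType) (B : {set {set T}}) : Prop :=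
  forall I J : {set T}, I \in B -> J \in B -> ~~ [disjoint I & J] ->
    (I \subset J) || (J \subset I).

(** For nonempty sets, this is the minimum of the coordinate sum over [J] on the Minkowski sum of
    the simplices dilated by [y]. *)
Definition below (T : finType) (B : {set {set T}}) (y : {set T} -> nat)
    (J : {set T}) : nat :=
  \sum_(I in B | I \subset J) y I.

(* Greedy: repeatedly move one unit of an inclusion-minimal [I] with
   [0 < y I] to a point of [I]; no other constraint inside [I] is active, and
   by laminarity every other active set meeting that point contains [I]. *)
Lemma laminar_decomposition (T : finType) (B : {set {set T}})
    (y : {set T} -> nat) (q : T -> nat) :
  laminar B ->
  (forall J, J \in B -> 0 < y J -> below B y J <= \sum_(i in J) q i) ->
  exists r : {set T} -> T -> nat,
    [/\ forall I, I \in B -> \sum_i r I i = y I,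
        forall (I : {set T}) i, i \notin I -> r I i = 0
      & forall i, \sum_(I in B) r I i <= q i].
Proof.
move=> lam; have [N] := ubnP (\sum_(I in B) y I).
elim: N y q => // N IH y q yN cond.
have [/existsP[I0 /andP[I0B yI0]]|] :=
    boolP [exists I : {set T}, (I \in B) && (0 < y I)]; last first.
  rewrite negb_exists => /forallP y0; exists (fun _ _ => 0); split=> //.
    move=> I IB; rewrite big1 //; have := y0 I; rewrite IB /= -eqn0Ngt.
    by move/eqP.
  by move=> i; rewrite big1.
case: (@arg_minnP _ I0 (fun I => (I \in B) && (0 < y I)) (fun I => #|I|));
  first by rewrite I0B.
move=> I /andP[IB yI] Imin.
have [t tI qt] : exists2 t, t \in I & 0 < q t.
  have : 0 < \sum_(i in I) q i.
    apply: leq_trans (cond _ IB yI); rewrite /below (bigD1 I) ?IB ?subxx //=.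
    by rewrite ltn_addr.
  by rewrite lt0n sum_nat_eq0 negb_forall_in => /exists_inP[t tI qt]; exists t; rewrite ?lt0n.
pose y' J := y J - (J == I); pose q' i := q i - (i == t).
have yE J : y J = y' J + (J == I) by rewrite /y'; case: eqP => [->|]; lia.
have qE i : q i = q' i + (i == t) by rewrite /q'; case: eqP => [->|]; lia.
have sumI (P : pred {set T}) : \sum_(J in B | P J) y J = \sum_(J in B | P J) y' J + P I.
  rewrite (eq_bigr _ (fun J _ => yE J)) big_split /=; congr (_ + _).
  have [PI|PI] := boolP (P I); last first.
    by rewrite big1 // => J /andP[_ PJ]; case: eqP PJ PI => // -> ->.
  rewrite (bigD1 I) ?IB //= eqxx big1 // => J /andP[_ /negbTE-> //].
have sumt (J : {set T}) : \sum_(i in J) q i = \sum_(i in J) q' i + (t \in J).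
  rewrite (eq_bigr _ (fun i _ => qE i)) big_split /=; congr (_ + _).
  have [tJ|tJ] := boolP (t \in J); last first.
    by rewrite big1 // => i iJ; case: eqP iJ tJ => // -> ->.
  by rewrite (bigD1 t) //= eqxx big1 // => i /andP[_ /negbTE->].
have [||r [r1 r2 r3]] := IH y' q'.
- have E : \sum_(J in B) y J = (\sum_(J in B) y' J).+1.
    rewrite (eq_bigr _ (fun J _ => yE J)) big_split /= -addn1; congr (_ + _).
    by rewrite (bigD1 I) //= eqxx big1 // => J /andP[_ /negbTE->].
  by move: yN; rewrite E.
- move=> J JB yJ'; have yJ : 0 < y J by rewrite yE; lia.
  have := cond _ JB yJ; rewrite /below sumI sumt.
  have [tJ|] := boolP (t \in J); last by lia.
  suff -> : I \subset J by lia.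
  have [|//|JI] := orP (lam _ _ IB JB _).
    by apply/pred0Pn; exists t; rewrite /= tI.
  have IJ : #|I| <= #|J| by apply: Imin; rewrite JB yJ.
  by have /eqP -> : J == I by rewrite eqEcard JI.
exists (fun J i => r J i + (J == I) && (i == t)); split.
- move=> J JB; rewrite big_split /= r1 // [RHS]yE; congr (_ + _).
  case: eqP => [_|_] /=; last by rewrite big1.
  by rewrite (bigD1 t) //= eqxx big1 // => i /negbTE->.
- move=> J i iJ; rewrite r2 //; case: eqP iJ => //= ->.
  by case: eqP => // ->; rewrite tI.
- move=> i; rewrite big_split /= [q i]qE leq_add //.
  rewrite (bigD1 I) //= eqxx /= big1 ?addn0 // => J /andP[_ /negbTE->] //.
Qed.

(** The decomposition [r] keeps all of [y I] inside [I], hence inside [U], and uses at most [q i] at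
    each point; so the inequalities extend from the family to arbitrary sets. *)
Lemma laminar_below_le (T : finType) (B : {set {set T}})
    (y : {set T} -> nat) (q : T -> nat) (U : {set T}) :
  laminar B ->
  (forall J, J \in B -> 0 < y J -> below B y J <= \sum_(i in J) q i) ->
  below B y U <= \sum_(i in U) q i.
Proof.
move=> lam /(laminar_decomposition lam)[r [r1 r2 r3]].
apply: (@leq_trans (\sum_(i in U) \sum_(I in B) r I i)); last first.
  by apply: leq_sum => i _; apply: r3.
rewrite exchange_big /= /below big_mkcondr /=.
apply: leq_sum => I IB; case: ifP => // IU.
rewrite -r1 // (bigID (fun i => i \in U)) /= [X in _ + X]big1 ?addn0 //.
by move=> i iU; apply: r2; apply: contra iU; apply: (fintype.subsetP IU).
Qed.

(** * Minkowski sums of simplices *)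

Local Open Scope ring_scope.
Local Open Scope classical_set_scope.

Lemma convex_setP (R : realType) (n : nat) (A : set 'rV[R]_n) :
  @convex_set R 'rV[R]_n A <->
  forall (x y : 'rV[R]_n) (t : R), 0 <= t -> t <= 1 -> A x -> A y ->
    A (t *: x + (1 - t) *: y).
Proof.
split=> [cA x y t t0 t1 /mem_set Ax /mem_set Ay|cA x y t /set_mem Ax /set_mem Ay].
  by have /set_mem := cA x y (Itv01 t0 t1) Ax Ay.
by apply/mem_set; apply: cA.
Qed.

Lemma convex_hull_convex (R : realType) (n : nat) (V : set 'rV[R]_n) :
  @convex_set R 'rV[R]_n (convex_hull V).
Proof.
apply/convex_setP => x y t t0 t1 Vx Vy C CV; have [/convex_setP cC _] := CV.
by apply: cC => //; [apply: Vx | apply: Vy].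
Qed.

Lemma sub_convex_hull (R : realType) (n : nat) (V : set 'rV[R]_n) :
  V `<=` convex_hull V.
Proof. exact: sub_gen_smallest. Qed.

Lemma convex_hull_min (R : realType) (n : nat) (V C : set 'rV[R]_n) :
  @convex_set R 'rV[R]_n C -> V `<=` C -> convex_hull V `<=` C.
Proof. by move=> cC VC; apply: smallest_sub. Qed.

Lemma dotD (R : realType) (n : nat) (c : 'cV[R]_n) (t u : R) (x y : 'rV[R]_n) :
  ((t *: x + u *: y) *m c) 0 0 = t * (x *m c) 0 0 + u * (y *m c) 0 0.
Proof. by rewrite mulmxDl -!scalemxAl !mxE. Qed.

(** An open half-space together with one point of its boundary: through this set, strict maximality
    passes from generators to their hull. *)
Lemma convex_exposed (R : realType) (n : nat) (c : 'cV[R]_n) (x : 'rV[R]_n) :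
  @convex_set R 'rV[R]_n [set v | v = x \/ (v *m c) 0 0 < (x *m c) 0 0].
Proof.
apply/convex_setP => u v t t0 t1 /= Hu Hv; rewrite dotD.
have [->|tn0] := eqVneq t 0.
  by rewrite subr0 !scale0r scale1r mul0r mul1r !add0r.
have [->|tn1] := eqVneq t 1.
  by rewrite subrr !scale0r scale1r mul0r mul1r !addr0.
have tp : 0 < t by rewrite lt_neqAle eq_sym tn0.
have tq : 0 < 1 - t by rewrite subr_gt0 lt_neqAle tn1.
case: Hu Hv => [->|Hu] [->|Hv].
- by left; rewrite -scalerDl addrC subrK scale1r.
- by right; nra.
- by right; nra.
- by right; nra.
Qed.

(** If [x] were not in [V], all of [V], hence its hull, would lie in an open half-space with [x] on
    its boundary. *)
Lemma vertex_convex_hull (R : realType) (n : nat) (V : set 'rV[R]_n)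
    (x : 'rV[R]_n) :
  vertex (convex_hull V) x -> V x.
Proof.
move=> [Vx [c cx]]; apply: contrapT => nVx.
have : convex_hull V `<=` [set v | (v *m c) 0 0 < (x *m c) 0 0].
  apply: convex_hull_min => [|v Vv /=].
    apply/convex_setP => u v t t0 t1 /= Hu Hv; rewrite dotD.
    have [->|tn0] := eqVneq t 0; first by rewrite subr0 mul0r mul1r add0r.
    have tp : 0 < t by rewrite lt_neqAle eq_sym tn0.
    nra.
  by apply: cx; [exact: sub_convex_hull | apply: contra_notN nVx => /eqP <-].
by move=> /(_ _ Vx) /=; rewrite ltxx.
Qed.

Lemma convex_scale (R : realType) (n : nat) (a : R) (A : set 'rV[R]_n) :
  @convex_set R 'rV[R]_n A -> @convex_set R 'rV[R]_n [set a *: v | v in A].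
Proof.
move=> /convex_setP cA; apply/convex_setP => _ _ t t0 t1 [u Au <-] [v Av <-].
exists (t *: u + (1 - t) *: v); first exact: cA.
by rewrite scalerDr !scalerA mulrC [a * (1 - t)]mulrC.
Qed.

Lemma convex_minkowski_sum (R : realType) (n : nat) (B : {set {set 'I_n}})
    (Q : {set 'I_n} -> set 'rV[R]_n) :
  (forall I, I \in B -> @convex_set R 'rV[R]_n (Q I)) ->
  @convex_set R 'rV[R]_n (minkowski_sum B Q).
Proof.
move=> cQ; apply/convex_setP => _ _ t t0 t1 [p Qp <-] [p' Qp' <-].
exists (fun I => t *: p I + (1 - t) *: p' I) => [I IB|].
  by have /convex_setP := cQ I IB; apply => //; [apply: Qp | apply: Qp'].
by rewrite big_split /= !scaler_sumr.
Qed.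

(** Summands are moved to vertices one at a time: with the others fixed, the sum is affine in one
    summand, so it is enough to test [C] at the vertices of its simplex. *)
Lemma minkowski_simplices_min (R : realType) (k : nat)
    (B : {set {set 'I_k.+1}}) (y : {set 'I_k.+1} -> R) (C : set 'rV[R]_k.+1) :
  @convex_set R 'rV[R]_k.+1 C ->
  (forall c : {set 'I_k.+1} -> 'I_k.+1, (forall I, I \in B -> c I \in I) ->
     C (\sum_(I in B) y I *: delta_mx 0 (c I))) ->
  minkowski_sum B (fun I => [set y I *: v | v in @simplex R k.+1 I]) `<=` C.
Proof.
move=> cC HC _ [p0 Hp0 <-].
have [p pP] : {p : {set 'I_k.+1} -> 'rV[R]_k.+1 &
    forall I, I \in B -> simplex I (p I) /\ p0 I = y I *: p I}.
  apply: (choice (P := fun I v => I \in B -> simplex I v /\ p0 I = y I *: v)) => I.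
  have [IB|_] := boolP (I \in B); last by exists 0.
  by have [v sv <-] := Hp0 I IB; exists v.
rewrite (eq_bigr (fun I => y I *: p I)) => [|I /pP[]//].
have ps0 : forall I, I \in B -> simplex I (p I) by move=> I /pP[].
move: p ps0 {pP Hp0}.
(* The list [l] holds the sets whose summand is not yet known to be a vertex. *)
suff gen (l : seq {set 'I_k.+1}) (p : {set 'I_k.+1} -> 'rV[R]_k.+1) :
    (forall I, I \in B -> simplex I (p I)) ->
    (forall I, I \in B -> I \notin l -> exists2 i, i \in I & p I = delta_mx 0 i) ->
    C (\sum_(I in B) y I *: p I).
  by move=> p pB; apply: (gen (enum B)) => // I IB; rewrite mem_enum IB.
elim: l p => [|I0 l IH] p ps pl.
  have [c cP] : {c : {set 'I_k.+1} -> 'I_k.+1 &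
      forall I, I \in B -> c I \in I /\ p I = delta_mx 0 (c I)}.
    apply: (choice (P := fun I i => I \in B -> i \in I /\ p I = delta_mx 0 i)) => I.
    have [IB|_] := boolP (I \in B); last by exists ord0.
    by have [i iI pI] := pl I IB isT; exists i.
  rewrite (eq_bigr (fun I => y I *: delta_mx 0 (c I))) => [|I /cP[_ ->]//].
  by apply: HC => I /cP[].
pose upd v I := if I == I0 then v else p I.
have [I0B|I0B] := boolP (I0 \in B); last first.
  apply: IH => // I IB Il; apply: pl => //.
  by rewrite in_cons negb_or Il andbT; apply: contraNneq I0B => <-.
suff : simplex I0 `<=` [set v | C (\sum_(I in B) y I *: upd v I)].
  move=> /(_ _ (ps _ I0B)) /=; congr C; apply: eq_bigr => I _.
  by rewrite /upd; case: eqP => [->|].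
apply: convex_hull_min.
  have /convex_setP cC' := cC; apply/convex_setP => u v t t0 t1 /= Cu Cv.
  rewrite (_ : \sum_(I in B) _ = t *: (\sum_(I in B) y I *: upd u I) +
     (1 - t) *: (\sum_(I in B) y I *: upd v I)); first exact: cC'.
  rewrite !scaler_sumr -big_split /=; apply: eq_bigr => I _; rewrite /upd.
  case: eqP => _; last by rewrite -scalerDl addrC subrK scale1r.
  by rewrite scalerDr !scalerA mulrC [y I * (1 - t)]mulrC.
move=> _ [i /= iI0 <-]; apply: IH => I IB; rewrite /upd.
  case: eqP => [->|_]; last exact: ps.
  by apply: sub_convex_hull; exists i.
case: eqP => [-> _|/eqP II0 Il]; first by exists i.
by apply: pl => //; rewrite in_cons negb_or II0.
Qed.

(** Removing one unit at [t] writes a row of total [m.+1] as [m] times a point of the simplex plus a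
    vertex. For total 0, any point of the simplex serves, and [I] is nonempty. *)
Lemma scaled_simplex_nat (R : realType) (n m : nat) (I : {set 'I_n})
    (r : 'I_n -> nat) :
  I != finset.set0 -> (forall i, i \notin I -> r i = 0%N) ->
  (\sum_i r i)%N = m ->
  [set (m%:R : R) *: v | v in simplex I] (\row_i (r i)%:R).
Proof.
move=> /set0Pn[i0 i0I]; elim: m r => [|m IH] r rI rm.
  exists (delta_mx 0 i0); first by apply: sub_convex_hull; exists i0.
  rewrite scale0r; apply/rowP => i; rewrite !mxE.
  by move/eqP: rm; rewrite sum_nat_eq0 => /forallP/(_ i)/eqP ->.
have [t rt] : exists t, (0 < r t)%N.
  apply/existsP; apply: contraT => /existsPn r0.
  by move: rm; rewrite big1 // => i _; apply/eqP; rewrite eqn0Ngt r0.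
have tI : t \in I by apply: contraTT rt => /rI ->.
pose r' i := (r i - (i == t))%N.
have rE i : r i = (r' i + (i == t))%N by rewrite /r'; case: eqP => [->|]; lia.
have [||v sv vE] := IH r'.
- by move=> i /rI; rewrite /r' => ->.
- move: rm; rewrite (eq_bigr _ (fun i _ => rE i)) big_split /=.
  have -> : (\sum_i (i == t) = 1)%N.
    by rewrite (bigD1 t) //= eqxx big1 // => i /negbTE->.
  by rewrite addn1 => -[].
pose a : R := m%:R / m.+1%:R.
have m1 : (m.+1%:R : R) != 0 by rewrite pnatr_eq0.
exists (a *: v + (1 - a) *: delta_mx 0 t).
  have /convex_setP := @convex_hull_convex R n [set delta_mx 0 i | i in [set` I]].
  apply=> //; first by rewrite divr_ge0 ?ler0n.
    by rewrite ler_pdivrMr ?ltr0n // mul1r ler_nat.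
  by apply: sub_convex_hull; exists t.
rewrite scalerDr !scalerA mulrBr mulr1 /a mulrCA mulfV // mulr1 vE -natrB //.
rewrite subSnn scale1r; apply/rowP => i; rewrite !mxE eqxx /= rE natrD.
by [].
Qed.

Definition laminar_points (k : nat) (B : {set {set 'I_k.+1}}) (y : {set 'I_k.+1} -> nat) :
  set 'rV[nat]_k.+1 :=
  [set q | (forall J, J \in B -> (below B y J <= \sum_(i in J) q 0%R i)%N) /\
           (\sum_i q 0%R i = \sum_(I in B) y I)%N].

(** A lattice point splits over the simplices by [laminar_decomposition]. Conversely, choosing one
    vertex [c I] in each simplex gives a lattice point within the bounds, and such sums generate the
    Minkowski sum. *)
Lemma convex_hull_laminar_points (R : realType) (k : nat) (B : {set {set 'I_k.+1}})
    (y : {set 'I_k.+1} -> nat) :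
  laminar B -> finset.set0 \notin B ->
  convex_hull [set map_mx (fun m : nat => (m%:R : R)) q | q in laminar_points B y] =
  minkowski_sum B (fun I => [set (y I)%:R *: v | v in @simplex R k.+1 I]).
Proof.
move=> lam B0; have ne I : I \in B -> I != finset.set0.
  by move=> IB; apply: contraNneq B0 => <-.
apply/seteqP; split.
  apply: convex_hull_min.
    by apply: convex_minkowski_sum => I _; apply/convex_scale/convex_hull_convex.
  move=> _ [q [qB qT] <-].
  have [r [r1 r2 r3]] := laminar_decomposition lam (fun J JB _ => qB J JB).
  (* The decomposition uses at most [q]; equal totals leave no slack at any coordinate. *)
  have rq i : (\sum_(I in B) r I i)%N = q 0%R i.
    have : (\sum_i \sum_(I in B) r I i = \sum_i q 0%R i)%N.
      by rewrite exchange_big /= qT; apply: eq_bigr => I /r1.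
    move=> E; apply/eqP; rewrite eqn_leq r3 leqNgt /=; apply/negP => lt.
    suff : (\sum_i \sum_(I in B) r I i < \sum_i q 0%R i)%N by rewrite E ltnn.
    rewrite (bigD1 i) //= [ltnRHS](bigD1 i) //= -addSn leq_add //.
    by apply: leq_sum => j _; apply: r3.
  exists (fun I => \row_i (r I i)%:R) => [I IB|].
    by apply: scaled_simplex_nat; [exact: ne | exact: r2 | exact: r1].
  apply/rowP => i; rewrite summxE mxE -rq natr_sum.
  by apply: eq_bigr => I _; rewrite mxE.
apply: minkowski_simplices_min; first exact: convex_hull_convex.
move=> c cB; apply: sub_convex_hull.
exists (\row_i \sum_(I in B | c I == i) y I)%N; last first.
  apply/rowP => i; rewrite !mxE summxE natr_sum big_mkcondr /=.
  apply: eq_bigr => I _; rewrite !mxE eqxx /= [i == _]eq_sym.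
  by case: eqP; rewrite ?mulr1 ?mulr0.
have sumc (P : pred 'I_k.+1) :
    (\sum_(i | P i) (\row_i \sum_(I in B | c I == i) y I) 0%R i =
     \sum_(I in B | P (c I)) y I)%N.
  rewrite (eq_bigr (fun i => \sum_(I in B | c I == i) y I)%N); last first.
    by move=> i _; rewrite mxE.
  rewrite [RHS](partition_big c P) /= => [|I /andP[]//].
  apply: eq_bigr => i Pi; apply: eq_bigl => I.
  by case: eqP => [->|]; rewrite ?Pi ?andbT ?andbF.
split=> [J JB|]; rewrite sumc; last by apply: eq_bigl => I; rewrite andbT.
rewrite /below [leqLHS]big_mkcondr [leqRHS]big_mkcondr /=.
apply: leq_sum => I IB; case: ifP => // IJ.
by rewrite (fintype.subsetP IJ) // cB.
Qed.

(** * Exposed vertices and integrality of the coefficients *)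

Lemma dot_delta (R : realType) (n : nat) (c : 'cV[R]_n) (i : 'I_n) :
  ((delta_mx 0 i : 'rV[R]_n) *m c) 0 0 = c i 0.
Proof.
rewrite mxE (bigD1 i) //= big1 => [|j /negbTE ji]; rewrite !mxE ?eqxx ?mul1r ?addr0 //.
by rewrite ji mul0r.
Qed.

Lemma simplex_max (R : realType) (n : nat) (I : {set 'I_n}) (a : 'I_n)
    (c : 'cV[R]_n) (v : 'rV[R]_n) :
  (forall i, i \in I -> i != a -> c i 0 < c a 0) -> simplex I v ->
  v = delta_mx 0 a \/ (v *m c) 0 0 < c a 0.
Proof.
move=> amax; rewrite -(dot_delta c a).
suff : simplex I `<=` [set v | v = delta_mx 0 a \/
    (v *m c) 0 0 < ((delta_mx 0 a : 'rV[R]_n) *m c) 0 0] by apply.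
apply: convex_hull_min; first exact: convex_exposed.
move=> _ [i /= iI <-]; have [->|ia] := eqVneq i a; first by left.
by right; rewrite !dot_delta amax.
Qed.

(** A functional with a unique maximiser on each simplex has a unique maximiser on the sum;
    positivity of [y I] keeps the maximum strict after dilation. *)
Lemma vertex_minkowski_sum (R : realType) (k : nat) (B : {set {set 'I_k.+1}})
    (y : {set 'I_k.+1} -> R) (c : 'cV[R]_k.+1)
    (a : {set 'I_k.+1} -> 'I_k.+1) :
  (forall I, I \in B -> 0 < y I) -> (forall I, I \in B -> a I \in I) ->
  (forall (I : {set 'I_k.+1}) i, I \in B -> i \in I -> i != a I -> c i 0 < c (a I) 0) ->
  vertex (minkowski_sum B (fun I => [set y I *: v | v in @simplex R k.+1 I]))
    (\sum_(I in B) y I *: delta_mx 0 (a I)).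
Proof.
move=> y0 aB amax; split.
  exists (fun I => y I *: delta_mx 0 (a I)) => // I IB.
  exists (delta_mx 0 (a I)) => //; apply: sub_convex_hull.
  by exists (a I) => //=; apply: aB.
exists c => _ [p Bp <-] neq.
have dot_sum (f : {set 'I_k.+1} -> 'rV[R]_k.+1) :
    ((\sum_(I in B) f I) *m c) 0 0 = \sum_(I in B) (f I *m c) 0 0.
  by rewrite mulmx_suml summxE.
have dotZ t (v : 'rV[R]_k.+1) : ((t *: v) *m c) 0 0 = t * (v *m c) 0 0.
  by rewrite -scalemxAl mxE.
have xE I : ((y I *: (delta_mx 0 (a I) : 'rV[R]_k.+1)) *m c) 0 0 = y I * c (a I) 0.
  by rewrite dotZ dot_delta.
have pI I : I \in B -> p I = y I *: delta_mx 0 (a I) \/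
    (p I *m c) 0 0 < ((y I *: (delta_mx 0 (a I) : 'rV[R]_k.+1)) *m c) 0 0.
  move=> IB; have [v sv <-] := Bp I IB.
  have [->|lt] := simplex_max (fun i iI => amax I i IB iI) sv; first by left.
  by right; rewrite xE dotZ ltr_pM2l ?y0.
have [J JB pJ] : exists2 J, J \in B & p J != y J *: delta_mx 0 (a J).
  apply/exists_inP; apply: contraNT neq => /exists_inPn pE.
  by apply/eqP/eq_bigr => I /pE; rewrite negbK => /eqP.
rewrite !dot_sum (bigD1 J) //= [ltRHS](bigD1 J) //=.
apply: ltr_leD; first by case: (pI J JB) => // E; rewrite E eqxx in pJ.
by apply: ler_sum => I /andP[IB _]; case: (pI I IB) => [->|/ltW].
Qed.

(* The functional ranks the elements of [J] below all others, so the vertex it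
   exposes has coordinate sum [\sum_(I in B | I \subset J) y I] over [J]. *)
Lemma integral_nestohedron_weights (R : realType) (k : nat)
    (B : {set {set 'I_k.+1}}) (y : {set 'I_k.+1} -> R) :
  finset.set0 \notin B -> (forall I, I \in B -> 0 < y I) ->
  integral_polytope
    (minkowski_sum B (fun I => [set y I *: v | v in @simplex R k.+1 I])) ->
  forall I, I \in B -> y I \is a Num.int.
Proof.
move=> B0 y0 intP.
have intJ (J : {set 'I_k.+1}) : \sum_(I in B | I \subset J) y I \is a Num.int.
  pose ht (i : 'I_k.+1) : nat := if i \in J then i : nat else (i + k.+1)%N.
  have ht_inj : injective ht.
    move=> i j; rewrite /ht; have := ltn_ord i; have := ltn_ord j.
    by case: ifP; case: ifP => _ _ ? ? ?; apply: val_inj => /=; lia.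
  have [a aP] : {a : {set 'I_k.+1} -> 'I_k.+1 & forall I, I \in B ->
      a I \in I /\ forall i, i \in I -> (ht i <= ht (a I))%N}.
    apply: (choice (P := fun (I : {set 'I_k.+1}) a => I \in B ->
      a \in I /\ forall i, i \in I -> (ht i <= ht a)%N)) => I.
    have [IB|_] := boolP (I \in B); last by exists ord0.
    have /set0Pn[i0 i0I] : I != finset.set0 by apply: contraNneq B0 => <-.
    by case: (@arg_maxnP _ i0 (mem I) ht i0I) => a aI amax; exists a.
  pose c : 'cV[R]_k.+1 := \col_i (ht i)%:R.
  have cmax (I : {set 'I_k.+1}) i :
      I \in B -> i \in I -> i != a I -> c i 0 < c (a I) 0.
    move=> IB iI ia; rewrite !mxE ltr_nat ltn_neqAle.
    by rewrite (inj_eq ht_inj) ia (aP I IB).2.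
  have vx := vertex_minkowski_sum y0 (fun I IB => (aP I IB).1) cmax.
  suff -> : \sum_(I in B | I \subset J) y I =
      \sum_(i in J) (\sum_(I in B) y I *: (delta_mx 0 (a I) : 'rV[R]_k.+1)) 0 i.
    by apply: rpred_sum => i _; apply: intP.
  rewrite (eq_bigr (fun i => \sum_(I in B) y I * (i == a I)%:R)); last first.
    move=> i _; rewrite summxE; apply: eq_bigr => I _.
    by rewrite !mxE eqxx.
  rewrite exchange_big /= big_mkcondr /=; apply: eq_bigr => I IB.
  rewrite -mulr_sumr -natr_sum.
  have [aI amax] := aP I IB.
  have -> : (\sum_(i in J) (i == a I) = (I \subset J))%N; last first.
    by case: (I \subset J); rewrite ?mulr1 ?mulr0.
  (* As [a I] has the highest rank in [I] and the elements of [J] have the lowest ranks, [I] lies in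
     [J] as soon as [a I] does. *)
  have -> : (I \subset J) = (a I \in J).
    apply/idP/idP => [/fintype.subsetP|aJ]; first exact.
    apply/fintype.subsetP => i /amax; rewrite /ht aJ; case: ifP => // _.
    by have := ltn_ord (a I); lia.
  have [aJ|aJ] := boolP (a I \in J).
    by rewrite (bigD1 (a I)) //= eqxx big1 // => i /andP[_ /negbTE->].
  by rewrite big1 // => i iJ; case: eqP aJ => // <-; rewrite iJ.
(* The coefficients are recovered from these sums by induction on cardinality, subtracting those of
   the proper subsets. *)
move=> I; have [m] := ubnP #|I|; elim: m I => // m IH I Im IB.
have := intJ I; rewrite (bigD1 I) /= ?IB ?subxx // => yI.
set rest := \sum_(_ | _) _ in yI.
suff restI : rest \is a Num.int.
  by have := rpredB yI restI; rewrite addrK.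
apply: rpred_sum => J /andP[/andP[JB JI] neq]; apply: IH => //.
have : (#|J| <= #|I|)%N by apply: subset_leq_card.
suff : #|J| != #|I| by lia.
by apply: contra neq => /eqP E; rewrite eqEcard JI E /=.
Qed.

(** * Fertilitopes are nestohedra *)

Local Open Scope nat_scope.

(** A Moebius inversion truncated at 0. The recursion over proper subsets is coded as an iteration
    of [step], whose value at [J] is stable from round [#|J|.+1] on. *)
Lemma truncated_inversion (T : finType) (B : {set {set T}})
    (f : {set T} -> nat) :
  exists y : {set T} -> nat,
    forall J, y J = f J - \sum_(I in B | I \proper J) y I.
Proof.
pose step (g : {set T} -> nat) J := f J - \sum_(I in B | I \proper J) g I.
have stable m m' (J : {set T}) : #|J| < m -> #|J| < m' ->
    iter m step (fun=> 0) J = iter m' step (fun=> 0) J.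
  elim: m m' J => // m IH [//|m'] J Jm Jm' /=; rewrite /step; congr (_ - _).
  apply: eq_bigr => I /andP[_ /proper_card IJ].
  by apply: IH; apply: leq_trans IJ _.
exists (fun J : {set T} => iter #|J|.+1 step (fun=> 0) J) => J.
rewrite [LHS]/= {1}/step; congr (_ - _); apply: eq_bigr => I /andP[_ IJ].
by apply: stable => //; apply: proper_card.
Qed.

Lemma below_proper (T : finType) (B : {set {set T}}) (y : {set T} -> nat)
    (J : {set T}) :
  J \in B -> below B y J = y J + \sum_(I in B | I \proper J) y I.
Proof.
move=> JB; rewrite /below (bigD1 J) ?JB ?subxx //=; congr (_ + _).
by apply: eq_bigl => I; rewrite finset.properEneq -andbA [(I != J) && _]andbC.
Qed.

(* A constraint with [y J = 0] is implied by those of the sets below [J]. *)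
Lemma laminar_points_of_lower_bounds (k : nat) (B : {set {set 'I_k.+1}})
    (f y : {set 'I_k.+1} -> nat) (q0 : 'rV[nat]_k.+1) :
  laminar B -> [set: 'I_k.+1]%SET \in B ->
  (forall J, y J = f J - \sum_(I in B | I \proper J) y I) ->
  (forall J, J \in B -> f J <= \sum_(i in J) q0 0%R i) ->
  \sum_i q0 0%R i = f [set: 'I_k.+1]%SET ->
  [set q : 'rV[nat]_k.+1 |
     (forall J, J \in B -> f J <= \sum_(i in J) q 0%R i) /\
     \sum_i q 0%R i = f [set: 'I_k.+1]%SET] =
  laminar_points [set I in B | 0 < y I]%SET y.
Proof.
move=> lam TB yE; set B' := [set I in B | 0 < y I]%SET.
have B'P I : (I \in B') = (I \in B) && (0 < y I) by rewrite inE.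
have sumB' (P : pred {set 'I_k.+1}) :
    \sum_(I in B' | P I) y I = \sum_(I in B | P I) y I.
  rewrite [LHS]big_mkcond [RHS]big_mkcond; apply: eq_bigr => I _.
  by rewrite B'P; case: (I \in B) => //=; case: (P I); rewrite ?andbF //; case: (y I).
have fle J : J \in B -> f J <= below B y J.
  by move=> JB; rewrite below_proper // {1}yE; lia.
have cond (q : 'rV[nat]_k.+1) : (forall J, J \in B -> f J <= \sum_(i in J) q 0%R i) ->
    forall J, J \in B -> 0 < y J -> below B y J <= \sum_(i in J) q 0%R i.
  move=> fq J JB; have := fq J JB; rewrite below_proper //.
  by have := yE J; lia.
have sumT (q : 'I_k.+1 -> nat) : \sum_(i in [set: 'I_k.+1]%SET) q i = \sum_i q i.
  by apply: eq_bigl => i; rewrite inE.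
have belowT : below B y [set: 'I_k.+1]%SET = \sum_(I in B) y I.
  by apply: eq_bigl => I; rewrite finset.subsetT andbT.
have sumB : \sum_(I in B') y I = \sum_(I in B) y I.
  by have := sumB' predT; rewrite !(eq_bigl _ _ (fun I => andbT _)).
(* One admissible point makes the weights sum exactly to [f] at the full set: [fle] bounds the sum
   from below and [laminar_below_le] from above. *)
have total (q : 'rV[nat]_k.+1) : (forall J, J \in B -> f J <= \sum_(i in J) q 0%R i) ->
    \sum_i q 0%R i = f [set: 'I_k.+1]%SET ->
    \sum_(I in B) y I = f [set: 'I_k.+1]%SET.
  move=> fq qT; apply/eqP; rewrite eqn_leq -{2}belowT fle // andbT.
  rewrite -belowT -qT -sumT.
  exact: (laminar_below_le (q := fun i => q 0%R i) _ lam (cond _ fq)).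
move=> fq0 q0T; apply/seteqP; split=> q /= [].
  move=> fq qT; split; last by rewrite sumB (total q).
  move=> J; rewrite B'P => /andP[JB yJ]; rewrite /below sumB'.
  exact: cond.
move=> Bq qT; split; last by rewrite qT sumB (total q0).
move=> J JB; apply: leq_trans (fle J JB) _.
apply: (laminar_below_le (q := fun i => q 0%R i)) => // I IB yI.
by have := Bq I; rewrite B'P IB yI /below sumB'; apply.
Qed.

(** * The laminar family of tight inequalities *)

Lemma interval_set_convex (n : nat) (J : {set 'I_n}) (i0 : 'I_n) :
  i0 \in J ->
  (forall i j l : 'I_n, i \in J -> j \in J -> i <= l <= j -> l \in J) ->
  interval_set J.
Proof.
move=> i0J conv.
case: (@arg_minnP _ i0 (mem J) (@nat_of_ord n) i0J) => a aJ amin.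
case: (@arg_maxnP _ i0 (mem J) (@nat_of_ord n) i0J) => b bJ bmax.
exists a, b; split; first exact: (amin b bJ).
apply/setP => l; rewrite inE; apply/idP/idP => [lJ|abl].
  by apply/andP; split; [exact: (amin l lJ) | exact: (bmax l lJ)].
exact: conv abl.
Qed.

(* The pairs of positions whose inequality in [dominance_bounds] is not implied
   by the inequalities of shorter pairs. *)
Definition tight_pair (n : nat) (w : nat -> nat) (p x : nat) : bool :=
  [&& p < x, x <= n, w x < w p & all (fun y => (p < y) ==> (w y < w x)) (iota 0 x)].

Lemma tight_pairP (n : nat) (w : nat -> nat) (p x : nat) :
  reflect [/\ p < x, x <= n, w x < w p & forall y, p < y < x -> w y < w x]
          (tight_pair n w p x).
Proof.
apply: (iffP and4P) => -[px xn wx H]; split=> //.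
  move=> y /andP[py yx]; move/allP: H => /(_ y).
  by rewrite mem_iota add0n yx py /=; apply.
apply/allP => y; rewrite mem_iota add0n /= => yx.
by apply/implyP => py; apply: H; rewrite py.
Qed.

(** If a dominated pair [(p, x)] is not tight, let [y] be the last position strictly between with
    value above [w x]. Then [p] dominates up to [y] and [y] up to [x], and the two inequalities add
    up. *)
Lemma dominance_bounds_tight (n : nat) (w Q : nat -> nat) :
  (forall i j, i <= n -> j <= n -> w i = w j -> i = j) ->
  dominance_bounds n w Q <->
  forall p x, tight_pair n w p x -> x - p < \sum_(p <= z < x) Q z.
Proof.
move=> winj; split=> [sys p x /tight_pairP[px xn wx H]|tight p x].
  apply: sys => [|y /andP[py yx]]; first by rewrite px.
  move: yx; rewrite leq_eqVlt => /orP[/eqP -> //|yx].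
  by apply: ltn_trans wx; apply: H; rewrite py.
have [d] := ubnP (x - p); elim: d p x => // d IH p x xd /andP[px xn] pmax.
have [tp|ntp] := boolP (tight_pair n w p x); first exact: tight.
have [y [yx wy ymax]] : exists y, [/\ p < y < x, w x < w y &
    forall z, y < z <= x -> w z < w y].
  have ex : exists y, (p < y < x) && (w x < w y).
    move: ntp; rewrite /tight_pair px xn pmax ?px ?leqnn //= => /allPn[y].
    rewrite mem_iota add0n negb_imply -leqNgt /= => yx /andP[py wxy].
    exists y; rewrite py yx ltn_neqAle wxy /= andbT; apply/eqP => E.
    by have := winj x y; lia.
  have ub y : (p < y < x) && (w x < w y) -> y <= x by lia.
  have [y /andP[yx wy] ymax] := ex_maxnP ex ub.
  exists y; split=> // z /andP[yz zx].
  have [->//|zx'] := eqVneq z x.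
  rewrite ltnNge; apply/negP => wz; have := ymax z; lia.
rewrite (@big_cat_nat _ _ _ y) /=; [|lia|lia].
have : y - p < \sum_(p <= z < y) Q z.
  by apply: IH => [||z zy]; [lia|lia|apply: pmax; lia].
have : x - y < \sum_(y <= z < x) Q z by apply: IH => //; lia.
lia.
Qed.

Definition colors_between (k : nat) (s : seq nat) (p x : nat) : {set 'I_k.+1} :=
  [set i : 'I_k.+1 | p <= nth 0 (marks s) i < x]%SET.

(** Each tight pair bounds a sum of parts over an interval of colors. Several pairs may give the
    same interval, so [f] keeps the largest bound; inverting [f] gives the coefficients, and sets
    with coefficient 0 are dropped. *)
Lemma valid_compositions_laminar_points (R : realType) (k : nat) (s : seq nat) :
  permutation s -> size (descents s) = k ->
  @valid_compositions R k s !=set0 ->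
  exists (B : {set {set 'I_k.+1}}) (y : {set 'I_k.+1} -> nat),
    [/\ binary_building_set B, forall I, I \in B -> 0 < y I &
        @valid_compositions R k s = laminar_points B y].
Proof.
move=> ps sk [q0 Vq0].
pose M := (\max_(x <- s) x).+1.
have sM : all (gtn M) s.
  by apply/allP => x xs /=; rewrite ltnS; exact: (@leq_bigmax_seq _ s predT id x xs isT).
have /and3P[s0 us _] := ps.
pose n := size s; pose w := nth 0 (M :: s); pose m i := nth 0 (marks s) i.
have szm : size (marks s) = k.+1 by rewrite size_marks sk.
have m_lt (i j : 'I_k.+1) : (m i < m j) = (i < j).
  have homo (a b : 'I_k.+1) : a < b -> m a < m b.
    by apply: (sorted_ltn_nth ltn_trans 0 (sorted_marks s)); rewrite inE szm.
  have [/homo-> //|ji|/val_inj->] := ltngtP i j; last by rewrite ltnn.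
  by apply/negbTE; rewrite -leqNgt ltnW ?homo.
have m_mark (i : 'I_k.+1) : m i \in marks s by rewrite mem_nth // szm.
have markP p : p < n -> w p.+1 < w p -> exists i : 'I_k.+1, m i = p.
  move=> pn wp; have pm : p \in marks s by rewrite (mem_marks _ s0 sM) pn.
  have ip : index p (marks s) < k.+1 by rewrite -szm index_mem.
  by exists (Ordinal ip); rewrite /m /= nth_index.
have winj i j : i <= n -> j <= n -> w i = w j -> i = j.
  move=> si sj /eqP; rewrite /w nth_uniq //= ?us ?andbT => [/eqP//|].
  by apply/negP => /(allP sM) /=; rewrite ltnn.
pose J p x := @colors_between k s p x.
have sumJ (q : 'rV[nat]_k.+1) p x :
    \sum_(p <= z < x) weight (marks s) (fun i => q 0%R (inord i)) z =
    \sum_(i in J p x) q 0%R i + #|J p x|.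
  rewrite sum_weight (@sum_weight_row _ _ _ (fun z => p <= z < x)) //.
  rewrite -sum1_card -big_split /=; apply: eq_big => i; first by rewrite inE.
  by rewrite addn1.
have VP (q : 'rV[nat]_k.+1) : @valid_compositions R k s q <->
    (forall p x, tight_pair n w p x -> x - p < \sum_(i in J p x) q 0%R i + #|J p x|) /\
    \sum_i q 0%R i + k = n.
  rewrite (valid_compositionsP R q ps sk sM) (dominance_bounds_tight _ winj).
  have E : \sum_(i < k.+1) (q 0%R i).+1 = \sum_i q 0%R i + k.+1.
    rewrite (eq_bigr (fun i => q 0%R i + 1)) => [|i _]; last by rewrite addn1.
    by rewrite big_split /= sum1_card card_ord.
  rewrite E addnS; split=> -[H1 H2].
    by split=> [p x /H1|]; [rewrite sumJ | case: H2].
  by split=> [p x /H1|]; [rewrite sumJ | rewrite H2].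
pose T := [set: 'I_k.+1]%SET.
pose tp (u : 'I_n.+1 * 'I_n.+1) := tight_pair n w u.1 u.2.
pose B : {set {set 'I_k.+1}} := (T |: [set J (val u.1) (val u.2) | u in tp])%SET.
(* The full set receives the exact total [n - k], which implies the bound of every tight pair
   involving all colors. Elsewhere [#|K|] is subtracted because each color weighs one more than its
   part. *)
pose f (K : {set 'I_k.+1}) := if K == T then n - k else
  \max_(u : 'I_n.+1 * 'I_n.+1 | tp u && (J u.1 u.2 == K)) (u.2 - u.1 + 1 - #|K|).
have inB p x : tight_pair n w p x -> J p x \in B.
  move=> t; have [px xn _ _] := tight_pairP _ _ _ _ t.
  have hp : p < n.+1 by lia.
  rewrite !inE; apply/orP; right; apply/imsetP.
  by exists (Ordinal hp, Ordinal (xn : x < n.+1)).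
have leqf p x : tight_pair n w p x -> J p x != T -> x - p + 1 - #|J p x| <= f (J p x).
  move=> t /negbTE nT; have [px xn _ _] := tight_pairP _ _ _ _ t.
  have hp : p < n.+1 by lia.
  rewrite /f nT; pose u := (Ordinal hp, Ordinal (xn : x < n.+1)).
  apply: (@leq_bigmax_cond _ _ (fun u : 'I_n.+1 * 'I_n.+1 => u.2 - u.1 + 1 - #|J p x|) u).
  by rewrite /tp /= t eqxx.
have VE : @valid_compositions R k s =
    [set q : 'rV[nat]_k.+1 |
       (forall K, K \in B -> f K <= \sum_(i in K) q 0%R i) /\ \sum_i q 0%R i = f T].
  have /VP[_ q0n] := Vq0.
  have sumT (q : 'I_k.+1 -> nat) : \sum_(i in T) q i = \sum_i q i.
    by apply: eq_bigl => i; rewrite inE.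
  apply/seteqP; split=> q /=.
    move=> /VP[H1 H2]; split; last by rewrite /f eqxx -H2 addnK.
    move=> K _; rewrite /f; case: eqP => [->|_]; first by rewrite sumT -H2 addnK.
    by apply/bigmax_leqP => u /andP[/H1 + /eqP <-]; rewrite leq_subLR addn1 addnC.
  move=> [H1 H2]; apply/VP; move: H2; rewrite /f eqxx => H2.
  have kn : k <= n by rewrite -q0n leq_addl.
  split; last by rewrite H2 subnK.
  move=> p x t; have [px xn _ _] := tight_pairP _ _ _ _ t.
  have [E|nT] := eqVneq (J p x) T.
    by rewrite E sumT H2 cardsT card_ord addnS ltnS subnK // (leq_trans (leq_subr _ _)).
  by have := leq_trans (leqf _ _ t nT) (H1 _ (inB _ _ t)); rewrite leq_subLR addn1 addnC.
have BP K : K \in B -> K = T \/ exists p x, tight_pair n w p x /\ K = J p x.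
  by rewrite !inE => /orP[/eqP ->|/imsetP[u tu ->]]; [left | right; exists u.1, u.2].
have lam : laminar B.
  move=> K K' /BP[->|[p [x [t ->]]]] /BP[->|[p' [x' [t' ->]]]];
    rewrite ?finset.subsetT ?orbT //.
  (* Tight pairs cannot cross: [a < a' < b < b'] would give [w a' < w b < w b' < w a']. *)
  have half a b a' b' : tight_pair n w a b -> tight_pair n w a' b' -> a <= a' ->
      ~~ [disjoint J a b & J a' b'] -> (J a b \subset J a' b') || (J a' b' \subset J a b).
    move=> /tight_pairP[ab bn wb H] /tight_pairP[ab' bn' wb' H'].
    rewrite leq_eqVlt => /orP[/eqP E _|aa'].
      rewrite -E; have [bb'|/ltnW bb'] := leqP b b'; apply/orP; [left|right];
        by apply/fintype.subsetP => i; rewrite !inE; lia.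
    case/pred0Pn => i /=; rewrite !inE => /andP[ib ib'].
    apply/orP; right; apply/fintype.subsetP => l; rewrite !inE.
    suff : b' <= b by lia.
    rewrite leqNgt; apply/negP => bb'.
    by have := H a'; have := H' b; lia.
  have [pp'|/ltnW pp'] := leqP p p'; first exact: half.
  by rewrite disjoint_sym orbC; apply: half.
have TB : T \in B by rewrite !inE eqxx.
(* This pair isolates one color; when [k > 0], its bound 1 makes the coefficient of the singleton
   positive. *)
have single (i : 'I_k.+1) : [set i]%SET = J (m i) (m i).+1 /\ tight_pair n w (m i) (m i).+1.
  have := m_mark i; rewrite (mem_marks _ s0 sM) => /andP[mn wm].
  split; last by apply/tight_pairP; split=> // y; lia.
  apply/setP => j; rewrite !inE -val_eqE /=.
  have := m_lt i j; have := m_lt j i; rewrite -/(m j) -/(m i); lia.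
have ne0 K : K \in B -> exists i, i \in K.
  move=> /BP[->|[p [x [t ->]]]]; first by exists ord0; rewrite inE.
  have /tight_pairP[px xn wx H] := t.
  have [||i mi] := markP p; first by lia.
    have [E|ne] := eqVneq p.+1 x; first by rewrite E.
    by apply: ltn_trans wx; apply: H; lia.
  by exists i; rewrite inE -/(m i) mi; lia.
have [y yE] := truncated_inversion B f.
have [f0 t0] : (forall K, K \in B -> f K <= \sum_(i in K) q0 0%R i) /\
    \sum_i q0 0%R i = f T.
  by move: Vq0; rewrite VE.
exists [set I in B | 0 < y I]%SET, y; split.
- split.
  + by rewrite inE; apply/negP => /andP[/ne0[i]]; rewrite inE.
  + move=> K; rewrite inE => /andP[KB _]; have [i iK] := ne0 _ KB.
    apply: (interval_set_convex iK) => a b l; case: (BP _ KB) => [->|[p [x [_ ->]]]].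
      by rewrite !inE.
    rewrite !inE -/(m a) -/(m b) -/(m l) => ap bp al.
    have := m_lt b l; have := m_lt l a; lia.
  + move=> i; rewrite inE; have [Ei ti] := single i; rewrite {1}Ei inB //=.
    rewrite yE big1 => [|I /andP[/ne0[j jI] /properP[+ [l]]]]; last first.
      rewrite inE => /fintype.subsetP/(_ j jI); rewrite inE => /eqP E /eqP ->.
      by rewrite -E jI.
    rewrite subn0; have [E|nT] := eqVneq [set i]%SET T.
      have k0 : k = 0.
        by apply: succn_inj; rewrite -[LHS]card_ord -cardsT -/T -E cards1.
      by rewrite E /f eqxx [X in n - X]k0 subn0.
    have := leqf _ _ ti; rewrite -Ei cards1 => /(_ nT); apply: leq_trans.
    by rewrite subSnn.
  + move=> I K; rewrite inE => /andP[IB _]; rewrite inE => /andP[KB _].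
    exact: (lam I K IB KB).
- by move=> I; rewrite inE => /andP[].
- rewrite VE; exact: laminar_points_of_lower_bounds f0 t0.
Qed.

(** * Realising a tree of weights by a permutation *)

Lemma dominance_bounds_transfer (n : nat) (w w' Q Q' : nat -> nat) :
  (forall i j, i <= n -> j <= n -> (w i < w j) = (w' i < w' j)) ->
  (forall z, z < n -> Q z = Q' z) ->
  dominance_bounds n w Q -> dominance_bounds n w' Q'.
Proof.
move=> ww QQ sys p x /andP[px xn] pmax.
have <- : \sum_(p <= z < x) Q z = \sum_(p <= z < x) Q' z.
  by apply: eq_big_nat => z zx; apply: QQ; lia.
by apply: sys => [|y yx]; [lia | rewrite ww ?pmax //; lia].
Qed.

Lemma dominance_bounds_transferE (n : nat) (w w' Q Q' : nat -> nat) :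
  (forall i j, i <= n -> j <= n -> (w i < w j) = (w' i < w' j)) ->
  (forall z, z < n -> Q z = Q' z) ->
  dominance_bounds n w Q <-> dominance_bounds n w' Q'.
Proof.
move=> ww QQ; split; apply: dominance_bounds_transfer => //.
  by move=> i j si sj; rewrite ww.
by move=> z /QQ.
Qed.

(** The layout is a sentinel at 0, a left block ending at its maximum in position [a], a right block
    for which position [a] acts as sentinel, and an increasing run above both blocks. A positive [p]
    inside the left block does not dominate [a], and no [p] with [0 < p <= a + b] dominates
    [(a + b).+1]. So only pairs from 0 leave a block, and [(0, n)] is the strongest of those
    reaching into the run. *)
Lemma dominance_bounds_cat (n a b : nat) (w Q : nat -> nat) :
  0 < a -> a + b < n ->
  (forall y, 0 < y <= n -> w y < w 0) ->
  (forall y, 0 < y < a -> w y < w a) ->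
  (forall y, a < y <= a + b -> w y < w a) ->
  (forall y, 0 < y <= a + b -> w y < w (a + b).+1) ->
  (forall y, a + b < y < n -> w y < w y.+1) ->
  (forall z, a + b <= z -> Q z = 0) ->
  dominance_bounds n w Q <->
  [/\ dominance_bounds a w Q, dominance_bounds b (fun p => w (a + p)) (fun z => Q (a + z))
    & n < \sum_(0 <= z < a + b) Q z].
Proof.
move=> a0 abn w0 wa wab wabS wn Q0.
have shift p x : p <= x -> \sum_(a + p <= z < a + x) Q z = \sum_(p <= z < x) Q (a + z).
  by move=> px; rewrite addnC big_addn addKn; apply: eq_bigr => i _; rewrite addnC.
have tail x : a + b <= x -> \sum_(0 <= z < x) Q z = \sum_(0 <= z < a + b) Q z.
  move=> abx; rewrite (@big_cat_nat _ _ _ (a + b)) //=.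
  rewrite [X in _ + X]big_nat_cond [X in _ + X]big1 ?addn0 // => z /andP[/andP[/Q0]].
  by [].
split=> [sys|[sysL sysR tot] p x /andP[px xn] pmax].
  split.
  - by move=> p x px; apply: sys; lia.
  - move=> p x px pmax; rewrite -shift; last by lia.
    have -> : x - p = (a + x) - (a + p) by lia.
    apply: sys => [|y yx]; first by lia.
    by have := pmax (y - a); rewrite subnKC; [apply; lia | lia].
  - rewrite -(tail n) ?(ltnW abn) // -{1}(subn0 n).
    by apply: sys => //; lia.
have [p0|p0] := posnP p.
  move: px pmax; rewrite {}p0 subn0 => x0 _.
  have [xa|ax] := leqP x a.
    by have := sysL 0 x; rewrite subn0; apply; [lia | move=> y yx; apply: w0; lia].
  have [xab|abx] := leqP x (a + b); last by rewrite tail; lia.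
  rewrite (@big_cat_nat _ _ _ a) //=; last by lia.
  have : a - 0 < \sum_(0 <= z < a) Q z.
    by apply: sysL => [|y yx]; [lia | apply: w0; lia].
  have : (x - a) - 0 < \sum_(0 <= z < x - a) Q (a + z).
    by apply: sysR => [|y yx]; [lia | rewrite addn0; apply: wab; lia].
  by rewrite -shift // addn0 subnKC; lia.
have [pa|ap] := ltnP p a.
  have [xa|ax] := ltnP x a; last by have := pmax a; have := wa p; lia.
  by apply: sysL => //; lia.
have [pab|abp] := ltnP p (a + b).
  have [xab|abx] := leqP x (a + b).
    have -> : \sum_(p <= z < x) Q z = \sum_(p - a <= z < x - a) Q (a + z).
      by rewrite -shift; [rewrite !subnKC //; lia | lia].
    have -> : x - p = (x - a) - (p - a) by lia.
    apply: sysR => [|y yx]; first by lia.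
    by rewrite subnKC //; apply: pmax; lia.
  by have := pmax (a + b).+1; have := wabS p; lia.
have := pmax p.+1; have [E|ne] := eqVneq p (a + b).
  by rewrite E; have := wabS (a + b); lia.
by have := wn p; lia.
Qed.

Lemma marksE (s : seq nat) (M : nat) :
  0 < size s -> all (gtn M) s ->
  marks s =
  [seq p <- iota 0 (size s) | nth 0 (M :: s) p.+1 < nth 0 (M :: s) p].
Proof.
case: s => // v s _ /= /andP[vM _]; rewrite vM; congr (_ :: _).
by rewrite /descents /= -[1]addn0 iotaDl filter_map.
Qed.

Lemma weight_cat (D1 D2 : seq nat) (q : nat -> nat) (z : nat) :
  weight (D1 ++ D2) q z =
  weight D1 q z + weight D2 (fun i => q (size D1 + i)) z.
Proof.
rewrite /weight size_cat (@big_cat_nat _ _ _ (size D1)) //= ?leq_addr //.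
congr (_ + _).
  rewrite big_nat_cond [RHS]big_nat_cond; apply: eq_bigl => i.
  by rewrite nth_cat; case: ltnP; rewrite ?andbF.
rewrite -{1}[size D1]add0n big_addn addKn; apply: eq_big => i.
  by rewrite nth_cat ltnNge leq_addl /= addnK.
by rewrite addnC.
Qed.

Lemma weight_shift (D : seq nat) (q : nat -> nat) (c z : nat) :
  weight [seq c + p | p <- D] q (c + z) = weight D q z.
Proof.
rewrite /weight size_map big_nat_cond [RHS]big_nat_cond; apply: eq_bigl => i.
by case: ltnP => // iD; rewrite (nth_map 0) // eqn_add2l.
Qed.

(* A laminar family of intervals refined to a binary tree: the leaves are the
   singletons, and every vertex carries its coefficient (0 if the interval is
   not in the family). *)
Inductive btree := Leaf of nat | Node of nat & btree & btree.

Fixpoint leaves (t : btree) : nat :=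
  if t is Node _ l r then leaves l + leaves r else 1.

Fixpoint total (t : btree) : nat :=
  match t with Leaf y => y | Node y l r => y + total l + total r end.

Fixpoint positive_leaves (t : btree) : bool :=
  match t with
  | Leaf y => 0 < y
  | Node _ l r => positive_leaves l && positive_leaves r
  end.

(* In a [Node], the left block ends with its maximum, a descent whose hook ends
   in the final increasing run or beyond, hence covers the whole right block. *)
Fixpoint perm_of (t : btree) : seq nat :=
  match t with
  | Leaf y => iota 1 y
  | Node y l r =>
      [seq size (perm_of r) + v | v <- perm_of l] ++ perm_of r ++
      iota (size (perm_of l) + size (perm_of r)).+1 y.+1
  end.

Fixpoint tree_bounds (t : btree) (q : nat -> nat) : Prop :=
  match t with
  | Leaf y => y <= q 0
  | Node _ l r =>
      [/\ tree_bounds l q, tree_bounds r (fun i => q (leaves l + i))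
        & total t <= \sum_(0 <= i < leaves t) q i]
  end.

(** With this size, the total required in [valid_compositionsP] becomes the sum of the coefficients
    of the tree. *)
Lemma size_perm_of (t : btree) : (size (perm_of t)).+1 = total t + leaves t.
Proof.
elim: t => [y|y l IHl r IHr] /=; first by rewrite size_iota addn1.
by rewrite !size_cat size_map /= size_iota; lia.
Qed.

Lemma perm_of_perm (t : btree) :
  perm_eq (perm_of t) (iota 1 (size (perm_of t))).
Proof.
elim: t => [y|y l IHl r IHr] /=; first by rewrite size_iota.
rewrite -[_ :: _]/(iota _ y.+1) !size_cat size_map size_iota.
set a := size _ in IHl *; set b := size _ in IHr *.
have -> : iota 1 (a + (b + y.+1)) = iota 1 b ++ iota b.+1 a ++ iota (a + b).+1 y.+1.
  have -> : a + (b + y.+1) = b + (a + y.+1) by lia.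
  by rewrite iotaD add1n iotaD addSn [b + a]addnC.
rewrite perm_catCA; apply: perm_cat => //; apply: perm_cat => //.
by rewrite -[b.+1]addn1 iotaDl; apply: perm_map.
Qed.

Lemma mem_perm_of (t : btree) (v : nat) :
  (v \in perm_of t) = (0 < v <= size (perm_of t)).
Proof. by rewrite (perm_mem (perm_of_perm t)) mem_iota add1n ltnS. Qed.

Lemma uniq_perm_of (t : btree) : uniq (perm_of t).
Proof. by rewrite (perm_uniq (perm_of_perm t)) iota_uniq. Qed.

Lemma perm_of_gt0 (t : btree) : positive_leaves t -> 0 < size (perm_of t).
Proof. by case: t => [y|y l r] /=; rewrite ?size_iota // !size_cat /= !addnS. Qed.

Definition sentinel (t : btree) : seq nat := (size (perm_of t)).+1 :: perm_of t.

Lemma nth_sentinel_le (t : btree) (p : nat) :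
  0 < p -> nth 0 (sentinel t) p <= size (perm_of t).
Proof.
case: p => // p _ /=; have [lt|ge] := ltnP p (size (perm_of t)); last by rewrite nth_default.
by have := mem_perm_of t (nth 0 (perm_of t) p); rewrite mem_nth // => /esym/andP[].
Qed.

Lemma sentinel_gt (t : btree) : all (gtn (size (perm_of t)).+1) (perm_of t).
Proof. by apply/allP => v; rewrite mem_perm_of => /andP[]. Qed.

Lemma marks_Leaf (y : nat) : 0 < y -> marks (perm_of (Leaf y)) = [:: 0].
Proof.
move=> y0; have n0 : 0 < size (perm_of (Leaf y)) by rewrite size_iota.
rewrite /marks /descents (eq_in_filter (a2 := pred0)) ?filter_pred0 //.
move=> i; rewrite mem_iota /= size_iota => iy.
by rewrite !nth_iota; lia.
Qed.

(** In the final run values equal positions, since it follows two blocks that exhaust the smaller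
    values. *)
Lemma nth_sentinel_Node (y : nat) (l r : btree) (p : nat) :
  nth 0 (sentinel (Node y l r)) p =
    if p == 0 then size (perm_of l) + size (perm_of r) + y.+2
    else if p <= size (perm_of l) then
      size (perm_of r) + nth 0 (sentinel l) p
    else if p <= size (perm_of l) + size (perm_of r) then
      nth 0 (sentinel r) (p - size (perm_of l))
    else if p <= size (perm_of l) + size (perm_of r) + y.+1 then p else 0.
Proof.
set a := size (perm_of l); set b := size (perm_of r); case: p => [|p].
  rewrite /sentinel /= !size_cat size_map /= size_iota; lia.
rewrite [LHS]/= -[_ :: _]/(iota _ y.+1) nth_cat size_map -/a -/b.
have [pa|ap] := ltnP p a; first by rewrite (nth_map 0).
rewrite nth_cat -/b; have -> : p.+1 - a = (p - a).+1 by lia.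
have [pab|abp] := ltnP (p - a) b.
  by have -> : p < a + b by lia.
have -> : (p < a + b) = false by lia.
have [py|yp] := ltnP p (a + b + y.+1).
  by rewrite nth_iota; lia.
by rewrite nth_default // size_iota; lia.
Qed.

Lemma nth_sentinel_last (t : btree) :
  positive_leaves t -> nth 0 (sentinel t) (size (perm_of t)) = size (perm_of t).
Proof.
case: t => [[//|y] _|y l r _].
  have -> : size (perm_of (Leaf y.+1)) = y.+1 := size_iota _ _.
  by rewrite -[LHS]/(nth 0 (iota 1 y.+1) y) nth_iota ?add1n.
rewrite nth_sentinel_Node /= !size_cat size_map /= size_iota.
set a := size _; set b := size _.
have -> : (a + (b + y.+1) == 0) = false by lia.
have -> : (a + (b + y.+1) <= a) = false by lia.
have -> : (a + (b + y.+1) <= a + b) = false by lia.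
by have -> : a + (b + y.+1) <= a + b + y.+1 by lia.
Qed.

Lemma nth_sentinel_lt (t : btree) (p : nat) :
  positive_leaves t -> 0 < p < size (perm_of t) ->
  nth 0 (sentinel t) p < size (perm_of t).
Proof.
move=> pt pn; rewrite ltn_neqAle nth_sentinel_le ?andbT; last by lia.
rewrite -(nth_sentinel_last pt).
have us : uniq (sentinel t).
  by rewrite /= uniq_perm_of andbT mem_perm_of ltnn andbF.
by rewrite (nth_uniq 0 _ _ us) /=; lia.
Qed.

(** The end of the left block is a descent into the right block, and is the image of the mark 0 of
    [r]. There is no descent from the end of the right block onwards. *)
Lemma marks_Node (y : nat) (l r : btree) :
  positive_leaves l -> positive_leaves r ->
  marks (perm_of (Node y l r)) =
  marks (perm_of l) ++ [seq size (perm_of l) + p | p <- marks (perm_of r)].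
Proof.
move=> pl pr; set a := size (perm_of l); set b := size (perm_of r).
have a0 : 0 < a := perm_of_gt0 pl; have b0 : 0 < b := perm_of_gt0 pr.
have n0 : 0 < size (perm_of (Node y l r)).
  by rewrite /= !size_cat /= !addnS.
rewrite (marksE n0 (sentinel_gt _)) (marksE a0 (sentinel_gt _)).
rewrite (marksE b0 (sentinel_gt _)) -/a -/b -!/(sentinel _).
have -> : size (perm_of (Node y l r)) = a + (b + y.+1).
  by rewrite /= !size_cat size_map /= size_iota.
rewrite iotaD filter_cat add0n; congr (_ ++ _).
  apply: eq_in_filter => p; rewrite mem_iota add0n => /andP[_ pa].
  rewrite !nth_sentinel_Node -/a -/b pa; case: p pa => [|p] pa /=.
    by have := nth_sentinel_le l (isT : 0 < 1); rewrite -/a /=; lia.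
  by rewrite (ltnW pa) ltn_add2l.
rewrite iotaD filter_cat -{1}[a]addn0 iotaDl filter_map.
rewrite (eq_in_filter (s := iota (a + b) _) (a2 := pred0)) ?filter_pred0 ?cats0; last first.
  move=> p; rewrite mem_iota => /andP[abp pn].
  rewrite !nth_sentinel_Node -/a -/b /=.
  have -> : (p == 0) = false by lia.
  have -> : (p.+1 <= a) = false by lia.
  have -> : (p <= a) = false by lia.
  have -> : (p.+1 <= a + b) = false by lia.
  have -> : (p.+1 <= a + b + y.+1) by lia.
  case: ifP => pab; last by case: ifP => _; lia.
  have := @nth_sentinel_le r (p - a); rewrite -/b; lia.
congr map; apply: eq_in_filter => p; rewrite mem_iota add0n => /andP[_ pb].
rewrite -[LHS]/(nth 0 (sentinel (Node y l r)) (a + p).+1 <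
  nth 0 (sentinel (Node y l r)) (a + p)).
rewrite -addnS !nth_sentinel_Node -/a -/b.
have -> : (a + p.+1 == 0) = false by lia.
have -> : (a + p == 0) = false by lia.
have -> : (a + p.+1 <= a) = false by lia.
have -> : (a + p.+1 <= a + b) by lia.
rewrite addKn; case: p pb => [|p] pb /=.
  rewrite addn0 leqnn (nth_sentinel_last pl) -/a.
  by have := nth_sentinel_le r (isT : 0 < 1); rewrite -/b /=; lia.
have -> : (a + p.+1 <= a) = false by lia.
have -> : (a + p.+1 <= a + b) by lia.
by rewrite addKn.
Qed.

Lemma size_marks_perm_of (t : btree) :
  positive_leaves t -> size (marks (perm_of t)) = leaves t.
Proof.
elim: t => [y y0|y l IHl r IHr /andP[pl pr]]; first by rewrite marks_Leaf.
by rewrite marks_Node // size_cat size_map IHl // IHr.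
Qed.

Lemma marks_lt_size (t : btree) (z : nat) :
  positive_leaves t -> z \in marks (perm_of t) -> z < size (perm_of t).
Proof.
by move=> pt; rewrite (mem_marks _ (perm_of_gt0 pt) (sentinel_gt t)) => /andP[].
Qed.

Lemma sum_weight_marks (t : btree) (q : nat -> nat) (x : nat) :
  positive_leaves t -> size (perm_of t) <= x ->
  \sum_(0 <= z < x) weight (marks (perm_of t)) q z =
  \sum_(0 <= i < leaves t) q i + leaves t.
Proof.
move=> pt tx; rewrite sum_weight size_marks_perm_of // big_nat_cond.
rewrite (eq_bigl (fun i => (0 <= i < leaves t) && true)); last first.
  move=> i /=; case: ltnP => //= it.
  by apply: leq_trans tx; apply: marks_lt_size; rewrite ?mem_nth ?size_marks_perm_of.
rewrite -big_nat_cond (eq_bigr (fun i => q i + 1)) => [|i _]; last by rewrite addn1.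
by rewrite big_split /= sum_nat_const_nat subn0 muln1.
Qed.

(** The inequality at the root is the one for the pair [(0, n)] ([tE]); for a [Node],
    [dominance_bounds_cat] reduces the rest to the subtrees. Only the relative order of values
    matters, so each block can be compared with the same block under its own sentinel. *)
Lemma dominance_bounds_perm_of (t : btree) (q : nat -> nat) :
  positive_leaves t ->
  dominance_bounds (size (perm_of t)) (nth 0 (sentinel t)) (weight (marks (perm_of t)) q) <->
  tree_bounds t q.
Proof.
elim: t q => [y|y l IHl r IHr] q.
  rewrite [positive_leaves _]/= => y0; rewrite marks_Leaf // size_iota.
  have sumQ x : 0 < x -> \sum_(0 <= z < x) weight [:: 0] q z = (q 0).+1.
    move=> x0; rewrite sum_weight /= /index_iota /= big_cons big_nil /= x0 addn0 //.
  split=> [sys|/= yq p x /andP[px xy] pmax].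
    have := sys 0 y; rewrite sumQ // subn0 ltnS /=; apply; first by lia.
    by move=> z /andP[z0 _]; rewrite ltnS; apply: nth_sentinel_le.
  have [p0|p0] := posnP p; first by rewrite p0 sumQ; lia.
  have := pmax p.+1; rewrite /sentinel /=; case: p px p0 {pmax} => // p px _ /=.
  by rewrite !nth_iota; lia.
move=> /andP[pl pr]; set a := size (perm_of l); set b := size (perm_of r).
have a0 : 0 < a := perm_of_gt0 pl; have b0 : 0 < b := perm_of_gt0 pr.
have nE : size (perm_of (Node y l r)) = a + b + y.+1.
  by rewrite /= !size_cat size_map /= size_iota -/a -/b addnA.
have wE p := nth_sentinel_Node y l r p; rewrite -/a -/b /= in wE.
set w := nth 0 (sentinel (Node y l r)); rewrite -/w in wE.
set Q := weight _ q.
have ml : {in marks (perm_of l), forall z, z < a} by move=> z; apply: marks_lt_size.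
have mr : {in marks (perm_of r), forall z, z < b} by move=> z; apply: marks_lt_size.
have QE z : Q z = weight (marks (perm_of l)) q z +
    weight [seq a + p | p <- marks (perm_of r)] (fun i => q (leaves l + i)) z.
  by rewrite /Q marks_Node // weight_cat size_marks_perm_of.
have QL z : z < a -> Q z = weight (marks (perm_of l)) q z.
  move=> za; rewrite QE [X in _ + X]weight_notin ?addn0 //.
  by apply/mapP => -[p _ E]; move: za; rewrite E; lia.
have QR z : Q (a + z) = weight (marks (perm_of r)) (fun i => q (leaves l + i)) z.
  rewrite QE weight_shift weight_notin //.
  by apply/negP => /ml; lia.
have Qab z : a + b <= z -> Q z = 0.
  move=> abz; have -> : z = a + (z - a) by lia.
  by rewrite QR weight_notin //; apply/negP => /mr; lia.
have w0 : w 0 = a + b + y.+2 by rewrite wE.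
have wL p : 0 < p <= a -> w p = b + nth 0 (sentinel l) p.
  by move=> pa; rewrite wE; case: eqP => [|_]; [lia | have -> : p <= a by lia].
have wR p : 0 < p <= b -> w (a + p) = nth 0 (sentinel r) p.
  move=> pb; rewrite wE; have -> : (a + p == 0) = false by lia.
  have -> : (a + p <= a) = false by lia.
  have -> : (a + p <= a + b) by lia.
  by rewrite addKn.
have wA p : a + b < p <= a + b + y.+1 -> w p = p.
  move=> pab; rewrite wE; have -> : (p == 0) = false by lia.
  have -> : (p <= a) = false by lia.
  have -> : (p <= a + b) = false by lia.
  by have -> : p <= a + b + y.+1 by lia.
have wLe p : 0 < p <= a -> w p <= a + b.
  by move=> pa; rewrite wL //; have := @nth_sentinel_le l p; rewrite -/a; lia.
have wRe p : 0 < p <= b -> w (a + p) <= b.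
  by move=> pb; rewrite wR //; have := @nth_sentinel_le r p; rewrite -/b; lia.
have wa : w a = a + b by rewrite wL ?a0 ?leqnn // nth_sentinel_last // -/a addnC.
have wab p : 0 < p <= a + b -> w p <= a + b.
  move=> pab; have [pa|ap] := leqP p a; first by apply: wLe; lia.
  by have := wRe (p - a); rewrite subnKC; lia.
rewrite nE (dominance_bounds_cat (a := a) (b := b)) //; first last.
- by move=> p pn; rewrite !wA; lia.
- by move=> p pab; rewrite (wA (a + b).+1); [have := wab p; lia | lia].
- by move=> p pab; rewrite wa; have := wRe (p - a); rewrite subnKC; lia.
- move=> p pa; rewrite wa wL; last by lia.
  by have := @nth_sentinel_lt l p pl; rewrite -/a; lia.
- move=> p pn; rewrite w0; have [pab|abp] := leqP p (a + b).
    by have := wab p; lia.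
  by rewrite wA; lia.
- by lia.
have tE : a + b + y.+1 < \sum_(0 <= z < a + b) Q z <->
    total (Node y l r) <= \sum_(0 <= i < leaves (Node y l r)) q i.
  have -> : \sum_(0 <= z < a + b) Q z = \sum_(0 <= z < a + b + y.+1) Q z.
    have tail0 : \sum_(a + b <= z < a + b + y.+1) Q z = 0.
      by rewrite big_nat_cond big1 // => z /andP[/andP[/Qab]].
    by rewrite [RHS](@big_cat_nat _ _ _ (a + b)) ?leq_addr //= tail0 addn0.
  rewrite sum_weight_marks; [|by apply/andP|by rewrite nE].
  have := size_perm_of (Node y l r); rewrite nE; lia.
have lE : dominance_bounds a w Q <-> tree_bounds l q.
  rewrite -(IHl q pl); apply: dominance_bounds_transferE => // i j ia ja.
  have wl p : p <= a -> (w p == a + b + y.+2) = (p == 0).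
    move=> pa; apply/eqP/eqP => [E|->]; last exact: w0.
    by have := wLe p; lia.
  case: i ia => [|i] ia; case: j ja => [|j] ja; rewrite ?ltnn //.
  - by rewrite w0; have := wLe j.+1; have := @nth_sentinel_le l j.+1; rewrite -/a /=; lia.
  - by rewrite w0; have := wLe i.+1; have := @nth_sentinel_le l i.+1; rewrite -/a /=; lia.
  - by rewrite !wL ?ltn_add2l.
(* Position [a] carries the value [a + b], above the whole right block, and stands for the sentinel
   of [r]. *)
have rE : dominance_bounds b (fun p => w (a + p)) (fun z => Q (a + z)) <->
    tree_bounds r (fun i => q (leaves l + i)).
  rewrite -(IHr _ pr); apply: dominance_bounds_transferE => // i j ib jb.
  case: i ib => [|i] ib; case: j jb => [|j] jb; rewrite ?ltnn // ?addn0.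
  - by rewrite wa; have := wRe j.+1; have := @nth_sentinel_le r j.+1; rewrite -/b /=; lia.
  - by rewrite wa; have := wRe i.+1; have := @nth_sentinel_le r i.+1; rewrite -/b /=; lia.
  - by rewrite !wR.
split=> [[/lE ? /rE ? /tE ?]|[? ? ?]]; first by split.
by split; [apply/lE | apply/rE | apply/tE].
Qed.

(** * From a binary building set to a tree *)

Definition seg (k lo hi : nat) : {set 'I_k.+1} :=
  [set i : 'I_k.+1 | lo <= i < hi]%SET.

Lemma interval_seg (k : nat) (I : {set 'I_k.+1}) :
  interval_set I -> exists a b, [/\ a < b, b <= k.+1 & I = seg k a b].
Proof.
by move=> [i [j [ij ->]]]; exists i, j.+1; split=> //; apply/setP => l; rewrite !inE.
Qed.

Lemma subset_seg (k a b lo hi : nat) :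
  a < b -> b <= k.+1 -> (seg k a b \subset seg k lo hi) = (lo <= a) && (b <= hi).
Proof.
move=> ab bk; apply/fintype.subsetP/idP => [sub|/andP[la bh] i]; last first.
  by rewrite !inE; lia.
have ak : a < k.+1 by lia.
have bk' : b.-1 < k.+1 by lia.
have := sub (Ordinal ak); have := sub (Ordinal bk'); rewrite !inE /=; lia.
Qed.

Lemma eq_seg (k a b lo hi : nat) :
  a < b -> b <= k.+1 -> lo < hi -> hi <= k.+1 ->
  seg k a b = seg k lo hi -> a = lo /\ b = hi.
Proof.
move=> ab bk lh hk E.
have := subset_seg lo hi ab bk; have := subset_seg a b lh hk.
by rewrite E subxx; lia.
Qed.

Lemma sum_seg (k lo hi : nat) (q : nat -> nat) :
  lo <= hi -> hi <= k.+1 ->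
  \sum_(i in seg k lo hi) q i = \sum_(0 <= i < hi - lo) q (lo + i).
Proof.
move=> lh hk.
rewrite (eq_bigl (fun i : 'I_k.+1 => lo <= i < hi)) => [|i]; last by rewrite inE.
rewrite -(big_mkord (fun i => lo <= i < hi)).
rewrite (@big_cat_nat _ _ _ lo) //=; last by lia.
rewrite [X in X + _]big_nat_cond [X in X + _]big1 ?add0n; last by move=> i; lia.
rewrite (@big_cat_nat _ _ _ hi) //=.
rewrite [X in _ + X]big_nat_cond [X in _ + X]big1 ?addn0; last by move=> i; lia.
rewrite big_nat_cond (eq_bigl (fun i => (lo <= i < hi) && true)) => [|i]; last first.
  by rewrite andbT andbb.
by rewrite -big_nat_cond -{1}[lo]add0n big_addn; apply: eq_bigr => i _; rewrite addnC.
Qed.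

(* An interval is split after its longest proper initial segment in [B]. *)
Lemma building_set_tree (k : nat) (B : {set {set 'I_k.+1}})
    (y : {set 'I_k.+1} -> nat) (lo hi : nat) :
  binary_building_set B -> (forall I, I \in B -> 0 < y I) ->
  lo < hi -> hi <= k.+1 ->
  exists t, [/\ positive_leaves t, leaves t = hi - lo,
    total t = below B y (seg k lo hi) &
    forall q, tree_bounds t (fun i => q (lo + i)) <->
      forall I, I \in B -> I \subset seg k lo hi ->
        below B y I <= \sum_(i in I) q i].
Proof.
move=> [B0 Bint B1 lam] y0.
have [m] := ubnP (hi - lo); elim: m lo hi => // m IH lo hi hm lh hk.
have Bseg I : I \in B -> exists a b, [/\ a < b, b <= k.+1 & I = seg k a b].
  by move=> /Bint/interval_seg.
have [E|lt1] := eqVneq hi lo.+1.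
  have lk : lo < k.+1 by lia.
  have segE : seg k lo hi = [set Ordinal lk]%SET.
    by apply/setP => i; rewrite !inE -val_eqE /= E; lia.
  have sub1 I : I \in B -> (I \subset [set Ordinal lk]%SET) = (I == [set Ordinal lk]%SET).
    by move=> IB; rewrite finset.subset1 orbC; case: eqP => // E0;
      rewrite E0 (negbTE B0) in IB.
  have bE : below B y [set Ordinal lk]%SET = y [set Ordinal lk]%SET.
    rewrite /below (bigD1 [set Ordinal lk]%SET) ?B1 ?subxx //= big1 ?addn0 //.
    by move=> I /andP[/andP[IB]]; rewrite sub1 // => ->.
  exists (Leaf (below B y (seg k lo hi))); split=> //=; [|lia|].
    by rewrite segE bE y0.
  move=> q; rewrite addn0 segE; split=> [yq I IB|].
    by rewrite sub1 // => /eqP ->; rewrite big_set1.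
  by move=> /(_ _ (B1 _) (subxx _)); rewrite big_set1.
have [c [c_in split_c]] : exists c, lo < c < hi /\
    forall I, I \in B -> I \subset seg k lo hi -> I != seg k lo hi ->
      (I \subset seg k lo c) || (I \subset seg k c hi).
  have ex : exists c, (lo < c < hi) && (seg k lo c \in B).
    have lk : lo < k.+1 by lia.
    exists lo.+1; have -> : seg k lo lo.+1 = [set Ordinal lk]%SET.
      by apply/setP => i; rewrite !inE -val_eqE /=; lia.
    by rewrite B1; lia.
  have ub c : (lo < c < hi) && (seg k lo c \in B) -> c <= hi by lia.
  have [c /andP[c_in cB] cmax] := ex_maxnP ex ub.
  exists c; split=> // I IB; have [a [b [ab bk IE]]] := Bseg _ IB.
  rewrite IE !subset_seg // => lab neq.
  have [bc|cb] := leqP b c; first by lia.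
  have [ca|ac] := leqP c a; first by lia.
  have : ~~ [disjoint I & seg k lo c].
    have ak : a < k.+1 by lia.
    by apply/pred0Pn; exists (Ordinal ak); rewrite /= IE !inE /=; lia.
  move=> /(lam _ _ IB cB); rewrite IE !subset_seg //; try lia.
  (* An [I] straddling [c] contains the segment from [lo] to [c] by laminarity, hence starts at
     [lo]; it would be a longer proper initial segment in [B]. *)
  move=> h; have al : a = lo by lia.
  have bh : b != hi by apply: contraNneq neq => ->; rewrite al.
  have bB : seg k lo b \in B by rewrite -al -IE.
  by have := cmax b; rewrite bB; lia.
have [||//|tl [pl ll tl_tot tl_b]] := IH lo c; [lia|lia|lia|].
have [||//|tr [pr lr tr_tot tr_b]] := IH c hi; [lia|lia|].
pose yT := if seg k lo hi \in B then y (seg k lo hi) else 0.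
have Z_split : below B y (seg k lo hi) =
    yT + below B y (seg k lo c) + below B y (seg k c hi).
  have -> : yT = \sum_(I in B) (if I == seg k lo hi then y I else 0).
    rewrite /yT; case: ifP => [sB|sB].
      by rewrite (bigD1 (seg k lo hi)) //= eqxx big1 ?addn0 // => I /andP[_ /negbTE->].
    by rewrite big1 // => I IB; case: eqP => // E; rewrite -E IB in sB.
  rewrite /below !big_mkcondr /= -!big_split /=.
  apply: eq_bigr => I IB; have [a [b [ab bk IE]]] := Bseg _ IB.
  have := split_c I IB; rewrite IE !subset_seg //.
  have [E|neq] := eqVneq (seg k a b) (seg k lo hi).
    have [||||al bh] := eq_seg _ _ _ _ E; try lia.
    by move=> _; rewrite ifT ?ifF ?addn0; lia.
  move=> h; have [lab|nlab] := boolP ((lo <= a) && (b <= hi)).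
    have := h lab isT; have [lc|nlc] := boolP ((lo <= a) && (b <= c)).
      by move=> _; rewrite ifF; lia.
    by move=> /= ->.
  by rewrite !ifF; lia.
exists (Node yT tl tr); split=> /=.
- by rewrite pl.
- by lia.
- by rewrite tl_tot tr_tot Z_split.
move=> q; rewrite ll lr tl_tot tr_tot -Z_split.
have -> : c - lo + (hi - c) = hi - lo by lia.
rewrite -(sum_seg q (ltnW lh) hk).
have shift i : lo + (c - lo + i) = c + i by lia.
have tr_b' : tree_bounds tr (fun i => q (lo + (c - lo + i))) <->
    forall I, I \in B -> I \subset seg k c hi -> below B y I <= \sum_(i in I) q i.
  rewrite -tr_b; have -> // : (fun i => q (lo + (c - lo + i))) = (fun i => q (c + i)).
  by apply: funext => i; rewrite shift.
split=> [[/tl_b bl /tr_b' br tot] I IB IS|bnd].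
  have [->//|neq] := eqVneq I (seg k lo hi).
  by have /orP[] := split_c I IB IS neq; [apply: bl | apply: br].
have subl : seg k lo c \subset seg k lo hi by rewrite subset_seg; lia.
have subr : seg k c hi \subset seg k lo hi by rewrite subset_seg; lia.
have bl I : I \in B -> I \subset seg k lo c -> below B y I <= \sum_(i in I) q i.
  by move=> IB IS; apply: (bnd _ IB); exact: (fintype.subset_trans IS subl).
have br I : I \in B -> I \subset seg k c hi -> below B y I <= \sum_(i in I) q i.
  by move=> IB IS; apply: (bnd _ IB); exact: (fintype.subset_trans IS subr).
split; [exact/tl_b | exact/tr_b' |].
(* If the segment is not in [B], its inequality is the sum of those at the roots of the two
   subtrees. *)
have [sB|sB] := boolP (seg k lo hi \in B); first exact: bnd.
have tot_le (t : btree) (p : nat -> nat) : tree_bounds t p ->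
    total t <= \sum_(0 <= i < leaves t) p i.
  by case: t => [z|z l r] /=; [rewrite big_nat1 | case].
have := tot_le _ _ (iffRL (tl_b q) bl); have := tot_le _ _ (iffRL (tr_b q) br).
have [lc ch] : lo <= c /\ c <= hi by lia.
have ck : c <= k.+1 by lia.
rewrite ll lr tl_tot tr_tot Z_split /yT (negbTE sB) add0n.
rewrite -(sum_seg q lc ck) -(sum_seg q ch hk) => hr hl.
have -> : \sum_(i in seg k lo hi) q i =
    \sum_(i in seg k lo c) q i + \sum_(i in seg k c hi) q i.
  rewrite (bigID (fun i => i \in seg k lo c)) /=.
  by congr (_ + _); apply: eq_bigl => i; rewrite !inE; lia.
exact: leq_add.
Qed.

(** The tree built for the whole segment of colors encodes exactly the bounds of [B], and its
    permutation realises them as dominance inequalities. *)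
Lemma laminar_points_valid_compositions (R : realType) (k : nat)
    (B : {set {set 'I_k.+1}}) (y : {set 'I_k.+1} -> nat) :
  binary_building_set B -> (forall I, I \in B -> 0 < y I) ->
  exists s, [/\ permutation s, size (descents s) = k &
    @valid_compositions R k s = laminar_points B y].
Proof.
move=> bB y0; have [t [pt lt tt tb]] := building_set_tree bB y0 (ltn0Sn k) (leqnn _).
have s0 := perm_of_gt0 pt.
have ps : permutation (perm_of t).
  rewrite /permutation s0 uniq_perm_of; apply/allP => v.
  by rewrite mem_perm_of => /andP[].
have sk : size (descents (perm_of t)) = k.
  by apply: succn_inj; rewrite -size_marks size_marks_perm_of // lt subn0.
exists (perm_of t); split=> //.
have segT : seg k 0 k.+1 = [set: 'I_k.+1]%SET.
  by apply/setP => i; rewrite !inE ltn_ord.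
have belowT : below B y [set: 'I_k.+1]%SET = \sum_(I in B) y I.
  by apply: eq_bigl => I; rewrite finset.subsetT andbT.
have E (q : 'rV[nat]_k.+1) : \sum_(i < k.+1) (q 0%R i).+1 = \sum_i q 0%R i + k.+1.
  rewrite (eq_bigr (fun i => q 0%R i + 1)) => [|i _]; last by rewrite addn1.
  by rewrite big_split /= sum1_card card_ord.
have inord_sum (q : 'rV[nat]_k.+1) (P : pred 'I_k.+1) :
    \sum_(i | P i) q 0%R (inord i) = \sum_(i | P i) q 0%R i.
  by apply: eq_bigr => i _; rewrite inord_val.
apply/seteqP; split=> q.
  move=> /(valid_compositionsP R q ps sk (sentinel_gt t))[].
  move=> /(dominance_bounds_perm_of _ pt)/(tb (fun i => q 0%R (inord i))) bnd tot.
  split=> [J JB|].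
    by rewrite -inord_sum; apply: bnd; rewrite ?segT ?finset.subsetT.
  move: tot; rewrite E size_perm_of lt subn0 tt segT belowT => /addIn //.
move=> [bnd tot]; apply/(valid_compositionsP R q ps sk (sentinel_gt t)); split.
  apply/(dominance_bounds_perm_of _ pt)/(tb (fun i => q 0%R (inord i))) => I IB _.
  by rewrite inord_sum; apply: bnd.
by rewrite E tot size_perm_of lt subn0 tt segT belowT.
Qed.

Theorem theorem3p2 (R : realType) (k : nat) (P : set 'rV[R]_k.+1) :
  polytope P -> P !=set0 ->
  (fertilitope P <-> integral_polytope P /\ binary_nestohedron P).
Proof.
move=> _ [x0 Px0]; split=> [[s [ps sk PE]]|[intP [B [y [bB y0 PE]]]]].
  (* The hull of the empty set is empty, so a point of [P] forces a valid composition to exist. *)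
  have Vne : @valid_compositions R k s !=set0.
    apply: contrapT => /set0P/negP/negPn/eqP V0; move: Px0; rewrite PE /Fer V0 image_set0.
    suff : convex_hull (set0 : set 'rV[R]_k.+1) `<=` set0 by apply.
    by apply: convex_hull_min => // u v t; rewrite inE.
  split.
    move=> x; rewrite PE => /vertex_convex_hull[q _ <-] i.
    by rewrite mxE; apply: Num.Theory.intr_nat.
  have [B [y [bB y0 VE]]] := valid_compositions_laminar_points ps sk Vne.
  exists B, (fun I => (y I)%:R)%R; split=> // [I IB|]; first by rewrite ltr0n y0.
  have [B0 _ _ lam] := bB.
  by rewrite PE /Fer VE; apply: convex_hull_laminar_points.
have [B0 _ _ lam] := bB.
(* The coefficients are positive integers, hence natural numbers [z I], and [P] is the hull of
   [laminar_points B z]. *)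
have yint := integral_nestohedron_weights B0 y0 (eq_ind _ (@integral_polytope R _) intP _ PE).
have [z zP] : {z : {set 'I_k.+1} -> nat & forall I, I \in B -> y I = ((z I)%:R)%R}.
  apply: (choice (P := fun I m => I \in B -> y I = (m%:R)%R)) => I.
  have [IB|_] := boolP (I \in B); last by exists 0.
  have : y I \is a Num.nat by rewrite natrEint yint //= ltW // y0.
  by move=> /natrP[m ym]; exists m.
have z0 I : I \in B -> 0 < z I by move=> IB; rewrite -(ltr0n R) -zP // y0.
have [s [ps sk VE]] := laminar_points_valid_compositions R bB z0.
exists s; split=> //; rewrite /Fer VE convex_hull_laminar_points // PE.
rewrite /minkowski_sum; congr image; apply/seteqP; split=> p Hp I IB; have := Hp I IB.
  by rewrite zP.
by rewrite zP.
Qed.
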